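(* Let $M$ be a first-order structure, $M^*\succ M$ a monster model, $G=G(M^* )$ a $\emptyset$-definable group, and let $H$ be an $M$-type-definable subgroup of $G$ which is normalized by $G(M)$. Let $N$ be the normal subgroup of $G$ generated by $H$. If $S_{G/H}(M)$ or $S_{H\backslash G}(M)$ carries a $G(M)$-invariant, Borel probability measure, then $$G^{00}_M\leq N\,G^{000}_M .$$
   Context: A monster model is a $\kappa$-saturated and strongly $\kappa$-homogeneous model for a sufficiently large cardinal $\kappa$ (strongly $\kappa$-homogeneous: every partial elementary map between subsets of cardinality $<\kappa$ extends to an automorphism); ''small'' or ''bounded'' means of cardinality $<\kappa$, and $M$ is small. $G$ denotes the interpretation of the group in $M^*$ and $G(M)$ its interpretation in $M$. $G^{00}_M$ is the smallest $M$-type-definable subgroup of $G$ of bounded index, and $G^{000}_M$ is the smallest subgroup of $G$ of bounded index which is invariant under $\mathrm{Aut}(M^*/M)$. $S_{G/H}(M)$ is the space of complete types over $M$ of left cosets of $H$ in $G$ (orbits of $\mathrm{Aut}(M^*/M)$ on $G/H$), a compact Hausdorff quotient of the type space $S_G(M)$ (complete types over $M$ concentrated on $G$); $G(M)$ acts by $g\cdot \mathrm{tp}(aH/M)=\mathrm{tp}(gaH/M)$. Similarly, $S_{H\backslash G}(M)$ is the compact space of complete types over $M$ of right cosets $Ha$, with the action of $G(M)$ induced by $g*(Ha)=gHa=H(ga)$, which is well defined because $H$ is normalized by $G(M)$. *)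

(* Defs.v *)
From HB Require Import structures.
From mathcomp Require Import all_boot all_order all_algebra.
From mathcomp Require Import all_classical all_reals all_analysis.

Set Implicit Arguments.
Unset Strict Implicit.
Unset Printing Implicit Defensive.

Local Open Scope classical_set_scope.
Local Open Scope card_scope.

Record language := Language {
  fsym : Type;
  farity : fsym -> nat;
  rsym : Type;
  rarity : rsym -> nat }.

Record structure (L : language) := Structure {
  universe :> Type;
  fun_interp : forall f : fsym L, ('I_(farity f) -> universe) -> universe;
  rel_interp : forall r : rsym L, ('I_(rarity r) -> universe) -> Prop;
  universe_nonempty : inhabited universe }.

(* The free variables of a formula range over an arbitrary type V, and the
   quantifier binds [None].  Formulas with parameters from a set A are formulas
   some of whose variables are elements of A, to be valued by the inclusion. *)
Inductive term (L : language) (V : Type) : Type :=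
| Var of V
| App (f : fsym L) of ('I_(farity f) -> term L V).

Inductive formula (L : language) (V : Type) : Type :=
| Bot
| Eq of term L V & term L V
| Rel (r : rsym L) of ('I_(rarity r) -> term L V)
| Imp of formula L V & formula L V
| All of formula L (option V).

Arguments Bot {L V}.

Definition opt_env (S V : Type) (b : S) (e : V -> S) (v : option V) : S :=
  if v is Some w then e w else b.

Definition sum_env (S V W : Type) (e : V -> S) (e' : W -> S) (v : V + W) : S :=
  match v with inl x => e x | inr y => e' y end.

Section Semantics.
Context (L : language) (S : structure L).

Fixpoint term_eval (V : Type) (e : V -> S) (t : term L V) : S :=
  match t with
  | Var v => e v
  | App f args => fun_interp (fun i => term_eval e (args i))
  end.

Fixpoint sat (V : Type) (e : V -> S) (phi : formula L V) : Prop :=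
  match phi with
  | Bot => False
  | Eq t u => term_eval e t = term_eval e u
  | Rel r args => rel_interp (fun i => term_eval e (args i))
  | Imp phi1 phi2 => sat e phi1 -> sat e phi2
  | All phi1 => forall b : S, sat (opt_env b e) phi1
  end.

Definition is_automorphism (s : S -> S) : Prop :=
  [/\ bijective s,
      forall (f : fsym L) (x : 'I_(farity f) -> S),
        s (fun_interp x) = fun_interp (s \o x)
    & forall (r : rsym L) (x : 'I_(rarity r) -> S),
        rel_interp x <-> rel_interp (s \o x)].

End Semantics.

(* A formula with variables in M, valued by the identity, is an arbitrary
   L-formula evaluated at an arbitrary tuple of M. *)
Definition elementary_embedding (L : language) (M N : structure L)
    (j : M -> N) : Prop :=
  forall phi : formula L M, sat id phi <-> sat j phi.

(* A cardinal is given by a type [kappa] of that cardinality; in the presence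
   of choice, not (kappa <= |A|) means |A| < kappa. *)
Definition small (kappa T : Type) (A : set T) : Prop :=
  ~ ([set: kappa] #<= A).

Section Monster.
Context (kappa : Type) (L : language) (S : structure L).

Definition saturated : Prop :=
  forall A : set S, small kappa A ->
  forall p : set (formula L (option A)),
    (forall q, finite_set q -> q `<=` p ->
       exists b : S, forall phi, q phi -> sat (opt_env b set_val) phi) ->
    exists b : S, forall phi, p phi -> sat (opt_env b set_val) phi.

Definition strongly_homogeneous : Prop :=
  forall A : set S, small kappa A ->
  forall f : A -> S,
    (forall phi : formula L A, sat set_val phi <-> sat f phi) ->
    exists2 s : S -> S, is_automorphism s & forall a : A, s (set_val a) = f a.

End Monster.

(* Formulas over L with variables in M are the L_M-sentences, and there are
   |L| + |M| + aleph_0 of them.  Since kappa exceeds the cardinal 2 to that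
   power, M is small and the smallest subgroups below do have index < kappa.
   Every strong limit kappa > |L| + |M| + aleph_0 qualifies. *)
Definition monster_model (kappa : Type) (L : language) (M S : structure L)
    (j : M -> S) : Prop :=
  [/\ elementary_embedding j,
      small kappa [set: set (formula L M)],
      saturated kappa S
    & strongly_homogeneous kappa S].

Section Subgroups.
Local Open Scope group_scope.
Context (G : groupType).
Implicit Types (A B H : set G) (a g : G).

Definition is_subgroup H : Prop :=
  [/\ H 1, forall x y, H x -> H y -> H (x * y) & forall x, H x -> H x^-1].

Definition left_coset H a : set G := [set a * h | h in H].
Definition right_coset H a : set G := [set h * a | h in H].

Definition prod_set A B : set G := [set a * b | a in A & b in B].

Definition normalizes g H : Prop := [set g * h * g^-1 | h in H] = H.

Definition normal_closure H : set G :=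
  smallest [set K | is_subgroup K /\ forall g, normalizes g K] H.

Definition bounded_index (kappa : Type) H : Prop :=
  small kappa (range (left_coset H)).

End Subgroups.

(* The group G = G(S): an abstract group identified by [coords] with a subset of
   S^ambient_dim defined by [domain], the graph of multiplication being defined by
   [mul_graph]. *)
Record definable_group (L : language) (S : structure L) := DefinableGroup {
  group :> groupType;
  ambient_dim : nat;
  coords : group -> ('I_ambient_dim -> S);
  domain : formula L 'I_ambient_dim;
  mul_graph : formula L ('I_ambient_dim + 'I_ambient_dim + 'I_ambient_dim);
  coords_inj : injective coords;
  range_coords : range coords = [set x | sat x domain];
  mul_graphP : forall x y z : group,
    (x * y)%g = z <->
    sat (sum_env (sum_env (coords x) (coords y)) (coords z)) mul_graph }.

Arguments coords {L S d}.

Section Components.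
Local Open Scope group_scope.
Context (L : language) (M S : structure L) (j : M -> S)
  (G : definable_group S).

Definition group_points : set G :=
  [set g | exists2 x : 'I_(ambient_dim G) -> M, sat x (domain G) & coords g = j \o x].

Definition tp (g : G) : set (formula L ('I_(ambient_dim G) + M)) :=
  [set phi | sat (sum_env (coords g) j) phi].

Definition type_definable (K : set G) : Prop :=
  exists p : set (formula L ('I_(ambient_dim G) + M)), K = [set g | p `<=` tp g].

Definition automorphism_over (s : S -> S) : Prop :=
  is_automorphism s /\ s \o j = j.

(* The image of K under the permutation of G induced by s. *)
Definition aut_image (s : S -> S) (K : set G) : set G :=
  [set g | exists2 k, K k & coords g = s \o coords k].

Definition aut_invariant (K : set G) : Prop :=
  forall s, automorphism_over s -> aut_image s K = K.

(* [smallest C set0] is the intersection of all the sets in the class C.  The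
   class is closed under intersections in both cases, because an index < kappa
   is at most 2^(|L| + |M| + aleph_0). *)
Definition G00 (kappa : Type) : set G :=
  smallest [set K | [/\ is_subgroup K, type_definable K
                      & bounded_index kappa K]] set0.

Definition G000 (kappa : Type) : set G :=
  smallest [set K | [/\ is_subgroup K, aut_invariant K
                      & bounded_index kappa K]] set0.

End Components.

Arguments group_points {L M S} j G.
Arguments G00 {L M S} j G kappa.
Arguments G000 {L M S} j G kappa.

HB.instance Definition _ (L : language) (V : Type) :=
  gen_eqMixin (formula L V).
HB.instance Definition _ (L : language) (V : Type) :=
  gen_choiceMixin (formula L V).
HB.instance Definition _ (L : language) (V : Type) :=
  isPointed.Build (formula L V) Bot.

Section TypeSpaces.
Local Open Scope group_scope.
Context (L : language) (M S : structure L) (j : M -> S)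
  (G : definable_group S).

(* S_G(M); by saturation every complete type over M concentrated on G is
   realized in G. *)
Definition type_space : Type := range (@tp L M S j G).

HB.instance Definition _ := Choice.on type_space.
HB.instance Definition _ := @isSubBaseTopological.Build type_space
  (formula L ('I_(ambient_dim G) + M)) setT (fun phi => [set p | set_val p phi]).

Definition realization (p : type_space) : G :=
  sval (cid2 (set_mem (valP p))).

(* The cosets are given by a function c, which is [left_coset H] for G/H and
   [right_coset H] for H\G.  The type over M of the coset c a is its orbit
   under Aut(S/M). *)
Context (c : G -> set G).

Definition coset_orbit (a : G) : set (set G) :=
  [set aut_image s (c a) | s in automorphism_over j].

Definition coset_type_space : Type := range coset_orbit.

Definition coset_type (a : G) : coset_type_space :=
  exist _ (coset_orbit a) (mem_set (imageT coset_orbit a)).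

(* The quotient map tp(a/M) |-> tp(c a/M).  It does not depend on the choice of
   the realization, by strong homogeneity and the M-invariance of H. *)
Definition coset_type_proj (p : type_space) : coset_type_space :=
  coset_type (realization p).

Definition coset_type_open (U : set coset_type_space) : Prop :=
  open (coset_type_proj @^-1` U).

Lemma coset_type_openT : coset_type_open setT.
Proof. by rewrite /coset_type_open preimage_setT; exact: openT. Qed.

Lemma coset_type_openI : setI_closed coset_type_open.
Proof. by move=> U V; exact: openI. Qed.

Lemma coset_type_open_bigcup (I : Type) (f : I -> set coset_type_space) :
  (forall i, coset_type_open (f i)) -> coset_type_open (\bigcup_i f i).
Proof.
move=> fo; rewrite /coset_type_open preimage_bigcup.
by apply: bigcup_open => i _; exact: fo.
Qed.

HB.instance Definition _ := Choice.on coset_type_space.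
HB.instance Definition _ := isPointed.Build coset_type_space (coset_type 1).
HB.instance Definition _ := @isOpenTopological.Build coset_type_space
  coset_type_open coset_type_openT coset_type_openI coset_type_open_bigcup.

(* The image of B under tp(c a/M) |-> tp(c (g a)/M). *)
Definition translate (g : G) (B : set coset_type_space) :
    set coset_type_space :=
  [set coset_type (g * a) | a in coset_type @^-1` B].

End TypeSpaces.

Definition borel (T : ptopologicalType) := g_sigma_algebraType (@open T).

Definition carries_invariant_probability (R : realType) (L : language)
    (M S : structure L) (j : M -> S) (G : definable_group S)
    (c : G -> set G) : Prop :=
  exists mu : probability (borel (coset_type_space j c)) R,
    forall g, group_points j G g ->
    forall B : set (borel (coset_type_space j c)), measurable B ->
      mu (translate g B) = mu B.

(* Main.v *)
From Stdlib Require List.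
Require Import Defs.
From mathcomp Require Import all_boot all_order all_algebra.
From mathcomp Require Import all_classical all_reals all_analysis.
From mathcomp Require Import lra.

(* Let X be the set of all a^-1 b with a, b of the same type over M, and Z the
   normal subgroup it generates; X lies in every M-invariant subgroup of bounded
   index, so Z is contained in G000.  Both families of cosets turn the measure
   into a left G(M)-invariant modular function nu on the M-type-definable sets E
   with H E H = E.

   Let C be an M-definable symmetric set containing H X H, and A a smaller one
   containing X, with H A H inside C.  Following Massicot and Wagner, one wants V
   inside C such that V A has nearly minimal measure; then every g for which
   V and g V still have a large intersection almost stabilizes Q = V A, and a
   product of k such elements of G(M) cannot move H Q H off itself.  To transfer
   this from G(M) to G, "large" must be definable, which measures are not.  It is
   replaced by the hierarchy of "ample" sets: V is ample at level i + 1 if among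
   any n_i translates of V two have an intersection that is ample at level i.
   Sets of measure at least t are ample at every level for suitable n_i, and by
   pigeonhole the minimal measure of V A hardly changes between two consecutive
   levels.  At such a level Y = {g | V and g V have an ample intersection} is
   M-definable, satisfies X <= Y Y, and Y^k lies in C^8.  Hence all powers of X
   lie in C^8, so that the M-type-definable closure cl(Z) of Z lies in (H X H)^8,
   a subset of N Z, where N is the normal closure of H.  Finally cl(Z) X = cl(Z) Z
   is an M-type-definable subgroup of bounded index, so it contains G00. *)

Set Implicit Arguments.
Unset Strict Implicit.
Unset Printing Implicit Defensive.

Import Order.TTheory GRing.Theory Num.Theory.
Local Open Scope classical_set_scope.
Local Open Scope card_scope.

(** * Cardinals *)

(** Negated, this is the working form of $|U|<|T|$; [smallTP] translates [small] into it. *)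
Definition embeds (T U : Type) : Prop := exists f : T -> U, injective f.

Lemma embeds_trans (T U V : Type) : embeds T U -> embeds U V -> embeds T V.
Proof. by move=> [f fI] [g gI]; exists (g \o f); exact: inj_comp. Qed.

Lemma card_le_setTP (T U : Type) (A : set U) :
  ([set: T] #<= A) <-> exists2 f : T -> U, injective f & forall t, A (f t).
Proof.
split.
  move=> /card_leP[f]; exists (fun t => val (f (exist _ t (mem_setT t)))).
    move=> x y /val_inj fxy.
    have /= := @inj _ _ _ f (exist _ x (mem_setT x)) (exist _ y (mem_setT y)).
    by move=> /(_ (mem_set I) (mem_set I) fxy) [].
  by move=> t; apply: set_mem; exact: valP.
move=> [f fI fA]; apply/card_leP/injfunPex.
exists (fun t : [set: T] => exist _ (f (val t)) (mem_set (fA _)) : A).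
  by [].
by move=> x y _ _ [] /fI /val_inj.
Qed.

Lemma embeds_total (T U : Type) : embeds T U \/ embeds U T.
Proof.
pose P (F : set (T * U)) :=
  forall p q, F p -> F q -> (p.1 = q.1 -> p.2 = q.2) /\ (p.2 = q.2 -> p.1 = q.1).
have [|R [PR Rmax]] := @Zorn_bigcup _ P.
  move=> C CP Ctot p q [F CF Fp] [F' CF' Fq].
  have [FF'|F'F] := Ctot _ _ CF CF'.
    by apply: (CP _ CF') => //; exact: FF'.
  by apply: (CP _ CF) => //; exact: F'F.
have [Tt|] := pselect (forall t, exists u, R (t, u)).
  left; have [f fR] := choice Tt; exists f => x y fxy.
  by have [_ /(_ fxy)] := PR _ _ (fR x) (fR y).
move=> /existsNP[t nt].
right; have [Ut|] := pselect (forall u, exists t, R (t, u)).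
  have [f fR] := choice Ut; exists f => x y fxy.
  by have [/(_ fxy)] := PR _ _ (fR x) (fR y).
move=> /existsNP[u nu]; exfalso.
apply: (Rmax (R `|` [set (t, u)])).
  split; first exact: subsetUl.
  by move=> /(_ (t, u) (or_intror erefl)) Rtu; apply: nt; exists u.
move=> p q [Rp|->] [Rq|->] //=; first exact: PR.
  by split => /esym e; exfalso; [apply: nt; exists p.2 | apply: nu; exists p.1];
    rewrite e; case: p Rp e.
by split => e; exfalso; [apply: nt; exists q.2 | apply: nu; exists q.1];
    rewrite e; case: q Rq e.
Qed.

(* Zorn's lemma on partial injections D * nat -> D, encoded by their graphs. *)
Lemma embeds_prod_nat (T : Type) : embeds nat T -> embeds (T * nat) T.
Proof.
move=> natT.
pose dom (F : set ((T * nat) * T)) x := exists n y, F ((x, n), y).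
pose P F := [/\ forall p q, F p -> F q ->
    (p.1 = q.1 -> p.2 = q.2) /\ (p.2 = q.2 -> p.1 = q.1),
  forall x n, dom F x -> exists y, F ((x, n), y) &
  forall p, F p -> dom F p.2].
have [|R [[PR Rtot Rdom] Rmax]] := @Zorn_bigcup _ P.
  move=> C CP Ctot; split.
  - move=> p q [F CF Fp] [F' CF' Fq].
    have [FF'|F'F] := Ctot _ _ CF CF'.
      by have [h _ _] := CP _ CF'; apply: h => //; exact: FF'.
    by have [h _ _] := CP _ CF; apply: h => //; exact: F'F.
  - move=> x n [m [y [F CF Fx]]]; have [_ h _] := CP _ CF.
    have [|z Fz] := h x n; first by exists m, y.
    by exists z, F.
  - move=> p [F CF Fp]; have [_ _ h] := CP _ CF.
    by have [n [y Fy]] := h _ Fp; exists n, y, F.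
have /choice[f fR] : forall a : {x | dom R x} * nat,
  exists y, R ((sval a.1, a.2), y).
  by move=> [[x Dx] n] /=; exact: Rtot.
have fI : injective f.
  move=> [[x Dx] m] [[y Dy] n] e.
  have [_ /(_ e)] := PR _ _ (fR (exist _ x Dx, m)) (fR (exist _ y Dy, n)).
  move=> /= [exy ->].
  by rewrite (_ : exist _ x Dx = exist _ y Dy) //; exact: eq_exist.
(* An infinite complement contradicts maximality: a copy $g$ of [nat] outside the domain could be
   adjoined, the pairs $(g_m,n)$ being sent to $g$ at their code. *)
have [Dinf|Dfin] := pselect (infinite_set (~` [set x | dom R x])).
  move/infiniteP/card_le_setTP: Dinf => [g gI gD]; exfalso.
  pose N := [set p : (T * nat) * T | exists m n, p = ((g m, n), g (pickle (m, n)))].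
  have domN x : dom N x <-> exists m, x = g m.
    split; first by move=> [n [y [m [k [-> _ _]]]]]; exists m.
    by move=> [m ->]; exists 0%N, (g (pickle (m, 0%N))), m, 0%N.
  apply: (Rmax (R `|` N)).
    split; first exact: subsetUl.
    have Np : N ((g 0%N, 0%N), g (pickle (0%N, 0%N))) by exists 0%N, 0%N.
    by move=> /(_ _ (or_intror Np)) Rg; apply: (gD 0%N); exists 0%N; eexists; exact: Rg.
  split.
  - move=> p q [Rp|[m [n ->]]] [Rq|[m' [n' ->]]] /=.
    + exact: PR.
    + split => e; exfalso.
        apply: (gD m'); exists n', p.2.
        by rewrite -e; case: p Rp {e} => -[].
      by apply: (gD (pickle (m', n'))); rewrite -e; exact: Rdom.
    + split => e; exfalso.
        apply: (gD m); exists n, q.2.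
        by rewrite e; case: q Rq {e} => -[].
      by apply: (gD (pickle (m, n))); rewrite e; exact: Rdom.
    + split => [[/gI -> ->] //|/gI /(pcan_inj pickleK)[-> ->] //].
  - move=> x n [m [y [Rx|Nx]]].
      have [|z Rz] := Rtot x n; first by exists m, y.
      by exists z; left.
    have /domN [k ->] : dom N x by exists m, y.
    by exists (g (pickle (k, n))); right; exists k, n.
  - move=> p [/Rdom[n [y Ry]]|]; first by exists n, y; left.
    move=> [m [n ->]] /=; exists 0%N, (g (pickle (pickle (m, n), 0%N))); right.
    by exists (pickle (m, n)), 0%N.
have {}Dfin : finite_set (~` [set x | dom R x]) by apply: contrapT.
have [x0 Dx0] : exists x, dom R x.
  apply: contrapT => nD; move: Dfin.
  rewrite (_ : ~` _ = setT); last by apply/seteqP; split=> // x _ Dx; apply: nD; exists x.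
  move=> /finite_setPn; apply; apply/card_le_setTP.
  by have [e eI] := natT; exists e.
move/finite_set_countable/countable_injP: Dfin => [h /= hI].
(* Points outside the domain go to $(x_0,h+1)$; the successor keeps them off $(x_0,0)$, the value at
   $x_0$. *)
have [k kI] : embeds T ({x | dom R x} * nat).
  exists (fun x => match pselect (dom R x) with
    | left Dx => (exist _ x Dx, 0%N)
    | right _ => (exist _ x0 Dx0, (h x).+1) end).
  move=> x y; case: pselect => Dx; case: pselect => Dy //.
    by case.
  by move=> [] /hI; apply; apply/mem_set.
exists (fun p => f ((k p.1).1, pickle ((k p.1).2, p.2))).
move=> [x m] [y n] /= /fI [e1 /(pcan_inj pickleK) [e2 ->]].
by congr (_, _); apply: kI; case: (k x) (k y) e1 e2 => a b [c d] /= -> ->.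
Qed.

Lemma smallTP (K T : Type) : small K [set: T] <-> ~ embeds K T.
Proof.
rewrite /small card_le_setTP.
by split=> h; apply: contra_not h => -[f fI]; exists f.
Qed.

Lemma small_range (K T U : Type) (f : T -> U) :
  ~ embeds K T -> small K (range f).
Proof.
move=> h /card_le_setTP[g gI gf]; apply: h.
have /choice[k kP] : forall x, exists t, f t = g x.
  by move=> x; have [t _ <-] := gf x; exists t.
by exists k => x y kxy; apply: gI; rewrite -!kP kxy.
Qed.

(** $K$ splits into the preimages of the two summands. The smaller one embeds into the larger, so
    $K$ embeds into the larger one times [nat]. That factor is absorbed if [nat] embeds into the
    larger one; otherwise $K$ would be countable. *)
Lemma not_embeds_sum (K T U : Type) : ~ embeds K nat ->
  ~ embeds K T -> ~ embeds K U -> ~ embeds K (T + U).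
Proof.
move=> Knat KT KU [f fI].
pose A := {k | exists t, f k = inl t}; pose B := {k | exists u, f k = inr u}.
have AT : embeds A T.
  exists (fun k : A => sval (cid (proj2_sig k))) => -[x px] [y py] /=.
  case: cid => t /= ft; case: cid => t' /= ft' e.
  by apply: eq_exist; apply: fI; rewrite ft ft' e.
have BU : embeds B U.
  exists (fun k : B => sval (cid (proj2_sig k))) => -[x px] [y py] /=.
  case: cid => t /= ft; case: cid => t' /= ft' e.
  by apply: eq_exist; apply: fI; rewrite ft ft' e.
have KAB : embeds K (A + B).
  have h k : {t | f k = inl t} + {u | f k = inr u}.
    by case: (f k) => [t|u]; [left; exists t | right; exists u].
  exists (fun k => match h k with
    | inl e => inl (exist _ k (ex_intro _ (sval e) (svalP e)))
    | inr e => inr (exist _ k (ex_intro _ (sval e) (svalP e))) end).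
  by move=> x y; case: (h x) => ?; case: (h y) => ? //= [].
have double (X Y : Type) : embeds X Y -> embeds (X + Y) (Y * nat).
  move=> [i iI]; exists (fun s => match s with inl x => (i x, 0) | inr y => (y, 1) end).
  by move=> [x|x] [y|y] //= [] => [/iI ->|->].
have absorb (X : Type) : embeds K (X * nat) -> embeds K X.
  move=> KX; have [natX|[i iI]] := embeds_total nat X.
    exact: embeds_trans KX (embeds_prod_nat natX).
  exfalso; apply/Knat/(embeds_trans KX).
  exists (fun p => pickle (i p.1, p.2)).
  by move=> [x m] [y n] /(pcan_inj pickleK) [/iI -> ->].
have [/double AB|/double BA] := embeds_total A B.
  by apply/KU/(embeds_trans _ BU)/absorb/(embeds_trans KAB AB).
apply/KT/(embeds_trans _ AT)/absorb/(embeds_trans _ BA)/(embeds_trans KAB).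
by exists (fun s => match s with inl x => inr x | inr x => inl x end) => -[x|x] [y|y] // [->].
Qed.

Lemma not_embeds_option (K T : Type) : ~ embeds K nat ->
  ~ embeds K T -> ~ embeds K (option T).
Proof.
move=> Knat KT KoT; apply: (@not_embeds_sum K T unit) => //.
  move=> Ku; apply: Knat; apply: embeds_trans Ku _.
  by exists (fun=> 0) => -[] [].
apply: embeds_trans KoT _.
exists (fun o => if o is Some t then inl t else inr tt).
by move=> [x|] [y|] // [->].
Qed.

Lemma not_embeds_prod_ord (K T : Type) n : ~ embeds K nat ->
  ~ embeds K T -> ~ embeds K (T * 'I_n).
Proof.
move=> Knat KT; elim: n => [|n IHn].
  move=> [f fI]; apply: Knat; exists (fun=> 0) => x.
  by case: (f x) => _ [].
have {}IHn := not_embeds_sum Knat KT IHn; apply: contra_not IHn => KTn.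
apply: embeds_trans KTn _.
exists (fun p => if unlift ord0 p.2 is Some i then inr (p.1, i) else inl p.1).
move=> [x m] [y k] /=.
by case: unliftP => [i ->|->]; case: unliftP => [i' ->|->] // [-> //] ->.
Qed.

(** * Formulas *)

Section Renaming.
Context (L : language).

Fixpoint term_map (V W : Type) (f : V -> W) (t : term L V) : term L W :=
  match t with
  | Var v => Var L (f v)
  | App g args => App (fun i => term_map f (args i))
  end.

Fixpoint rename (V W : Type) (f : V -> W) (phi : formula L V) : formula L W :=
  match phi with
  | Bot => Bot
  | Eq t u => Eq (term_map f t) (term_map f u)
  | Rel r args => Rel (fun i => term_map f (args i))
  | Imp phi1 phi2 => Imp (rename f phi1) (rename f phi2)
  | All phi1 => All (rename (omap f) phi1)
  end.

Lemma term_eval_map (S : structure L) V W (f : V -> W) (e : W -> S) t :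
  term_eval e (term_map f t) = term_eval (e \o f) t.
Proof.
by elim: t => //= g args IH; congr fun_interp; apply/funext => i; exact: IH.
Qed.

Lemma opt_env_omap (S : Type) V W (f : V -> W) (b : S) (e : W -> S) :
  opt_env b e \o omap f = opt_env b (e \o f).
Proof. by apply/funext => -[]. Qed.

Lemma sat_rename (S : structure L) V W (f : V -> W) (e : W -> S) phi :
  sat e (rename f phi) <-> sat (e \o f) phi.
Proof.
elim: phi W f e => {V} //=.
- by move=> V t u W f e; rewrite !term_eval_map.
- move=> V r args W f e; rewrite (_ : (fun _ => _) =
    (fun i => term_eval (e \o f) (args i))) //.
  by apply/funext => i; rewrite term_eval_map.
- by move=> V phi IH1 psi IH2 W f e; rewrite IH1 IH2.
- by move=> V phi IH W f e; split=> h b; have := h b;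
    rewrite IH opt_env_omap.
Qed.

Definition Not (V : Type) (phi : formula L V) : formula L V := Imp phi Bot.

Definition And (V : Type) (phi psi : formula L V) : formula L V :=
  Not (Imp phi (Not psi)).

Definition Ex (V : Type) (phi : formula L (option V)) : formula L V :=
  Not (All (Not phi)).

Definition conjunction (V : Type) (q : seq (formula L V)) : formula L V :=
  foldr (@And V) (Not Bot) q.

(** Turns the first variable of a block into the one bound by the outer quantifier, so that a block
    can be peeled one variable at a time. *)
Definition block_assoc n (V : Type) (v : V + 'I_n.+1) : option V + 'I_n :=
  match v with
  | inl w => inl (Some w)
  | inr i => if unlift ord0 i is Some k then inr k else inl None
  end.

Definition drop_block0 (V : Type) (v : V + 'I_0) : V :=
  match v with
  | inl w => w
  | inr (Ordinal _ h) => False_rect V (notF h)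
  end.

Fixpoint Exs n (V : Type) : formula L (V + 'I_n) -> formula L V :=
  match n return formula L (V + 'I_n) -> formula L V with
  | 0 => rename (@drop_block0 V)
  | n'.+1 => fun phi => Ex (Exs (rename (@block_assoc n' V) phi))
  end.

Context (S : structure L).

Lemma sat_Not V (e : V -> S) phi : sat e (Not phi) <-> ~ sat e phi.
Proof. by []. Qed.

Lemma sat_And V (e : V -> S) phi psi :
  sat e (And phi psi) <-> sat e phi /\ sat e psi.
Proof.
split=> /=; last by move=> [h1 h2] h; exact: h.
by move=> h; split; apply: contrapT => n; apply: h.
Qed.

Lemma sat_Ex V (e : V -> S) phi :
  sat e (Ex phi) <-> exists b : S, sat (opt_env b e) phi.
Proof.
split=> /=; last by move=> [b h] /(_ b h).
by move=> h; apply: contrapT => n; apply: h => b hb; apply: n; exists b.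
Qed.

Lemma sat_conjunction V (e : V -> S) q :
  sat e (conjunction q) <-> forall phi, phi \in q -> sat e phi.
Proof.
elim: q => [|phi q IH]; first by split=> [_ phi|_ []]; rewrite ?in_nil.
rewrite [conjunction _]/= sat_And IH; split.
  by move=> [h1 h2] psi; rewrite inE => /orP[/eqP ->|/h2].
move=> h; split; first by apply: h; rewrite mem_head.
by move=> psi psiq; apply: h; rewrite inE psiq orbT.
Qed.

Definition ord_cons n (b : S) (y : 'I_n -> S) (i : 'I_n.+1) : S :=
  if unlift ord0 i is Some k then y k else b.

Lemma ord_consE n (y : 'I_n.+1 -> S) :
  y = ord_cons (y ord0) (y \o lift ord0).
Proof.
by apply/funext => i; rewrite /ord_cons; case: unliftP => [k ->|->].
Qed.

Lemma block_assoc_env n V (e : V -> S) b (y : 'I_n -> S) :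
  sum_env (opt_env b e) y \o @block_assoc n V = sum_env e (ord_cons b y).
Proof.
by apply/funext => -[w|i] //=; rewrite /ord_cons; case: unlift.
Qed.

Lemma sat_Exs n V (e : V -> S) phi :
  sat e (@Exs n V phi) <-> exists y, sat (sum_env e y) phi.
Proof.
elim: n V e phi => [|n IH] V e phi.
  rewrite /= sat_rename.
  set f := _ \o _.
  have fE y : sum_env e y = f by apply/funext => -[w|[]].
  split=> [h|[y]]; last by rewrite fE.
  by exists (fun i : 'I_0 => False_rect S (notF (ltn_ord i))); rewrite fE.
rewrite [Exs _]/= sat_Ex; split.
  move=> [b] /IH[y]; rewrite sat_rename block_assoc_env => h.
  by exists (ord_cons b y).
move=> [y]; rewrite (ord_consE y) -block_assoc_env -sat_rename => h.
by exists (y ord0); apply/IH; exists (y \o lift ord0).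
Qed.

Lemma term_eval_aut (s : S -> S) V (e : V -> S) (t : term L V) :
  is_automorphism s -> s (term_eval e t) = term_eval (s \o e) t.
Proof.
move=> [_ sf _]; elim: t => //= f args IH; rewrite sf.
by congr fun_interp; apply/funext => i /=.
Qed.

Lemma sat_aut (s : S -> S) V (e : V -> S) (phi : formula L V) :
  is_automorphism s -> sat e phi <-> sat (s \o e) phi.
Proof.
move=> sa; have [sbij _ sr] := sa.
elim: phi e => {V} //=.
- move=> V t u e; rewrite -!term_eval_aut //; split=> [->//|].
  exact: bij_inj.
- move=> V r args e; rewrite sr (_ : s \o _ =
    (fun i => term_eval (s \o e) (args i))) //.
  by apply/funext => i /=; rewrite term_eval_aut.
- by move=> V phi IH1 psi IH2 e; rewrite IH1 IH2.
- have oe V b (e : V -> S) : s \o opt_env b e = opt_env (s b) (s \o e).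
    by apply/funext => -[].
  move=> V phi IH e; split=> h b; last by rewrite IH oe.
  by have [s' _ s'K] := sbij; have := h (s' b); rewrite IH oe s'K.
Qed.

End Renaming.

(** [saturated] speaks of types in one variable. The first coordinate $b$ realizes the formulas
    saying that finite parts of [Phi] can be completed; the remaining coordinates come from the
    induction hypothesis with $b$ as a further parameter. *)
Lemma saturated_block (K : Type) (L : language) (S : structure L) :
  ~ embeds K nat -> saturated K S ->
  forall n (W : Type) (e : W -> S) (Phi : set (formula L (W + 'I_n))),
  ~ embeds K W ->
  (forall q : seq (formula L (W + 'I_n)), (forall phi, phi \in q -> Phi phi) ->
    exists y, forall phi, phi \in q -> sat (sum_env e y) phi) ->
  exists y, forall phi, Phi phi -> sat (sum_env e y) phi.
Proof.
move=> Knat Ksat; elim=> [|n IH] W e Phi KW fin.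
  have [y0 _] : exists y : 'I_0 -> S, forall phi, phi \in [::] ->
    sat (sum_env e y) phi by apply: fin.
  exists y0 => phi Pphi; have [|y /(_ phi)] := fin [:: phi].
    by move=> psi; rewrite inE => /eqP ->.
  rewrite (_ : y = y0); last by apply/funext => -[].
  by apply; rewrite inE.
pose A := range e; pose r (w : W) : A := exist _ (e w) (mem_set (imageT e w)).
pose F (q : seq (formula L (W + 'I_n.+1))) : formula L (option A) :=
  rename (omap r) (Exs (rename (@block_assoc n W) (conjunction q))).
have satF q b : sat (opt_env b set_val) (F q) <->
    exists y, forall phi, phi \in q -> sat (sum_env e (ord_cons b y)) phi.
  rewrite /F sat_rename sat_Exs.
  rewrite (_ : opt_env _ _ \o omap _ = opt_env b e); last first.
    by apply/funext => -[].
  by split=> -[y hy]; exists y; move: hy; rewrite sat_rename block_assoc_env sat_conjunction.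
pose p := [set F q | q in [set q | forall phi, phi \in q -> Phi phi]].
have [Q /finite_seqP[s ->] sp|b bp] := Ksat A (small_range KW) p.
  (* Finitely many formulas [F q] all follow from the one for the concatenated list. *)
  have [q qPhi qF] : exists2 q, (forall phi, phi \in q -> Phi phi) &
      forall b, sat (opt_env b set_val) (F q) ->
      forall psi, psi \in s -> sat (opt_env b set_val) psi.
    elim: s sp => [|psi s IHs] sp; first by exists [::] => // b _ psi; rewrite in_nil.
    have [|q qPhi qs] := IHs.
      by move=> chi chis; apply: sp; rewrite /= inE chis orbT.
    have [q' q'Phi q'psi] : p psi by apply: sp; rewrite /= mem_head.
    exists (q' ++ q).
      by move=> phi; rewrite mem_cat => /orP[/q'Phi|/qPhi].
    move=> b /satF[y hy] chi; rewrite inE => /orP[/eqP ->|]; last first.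
      apply: qs; apply/satF; exists y => phi phiq; apply: hy.
      by rewrite mem_cat phiq orbT.
    rewrite -q'psi; apply/satF; exists y => phi phiq; apply: hy.
    by rewrite mem_cat phiq.
  have [y hy] := fin q qPhi.
  exists (y ord0) => psi /= psis; apply: (qF (y ord0)) => //.
  by apply/satF; exists (y \o lift ord0); rewrite -ord_consE.
have [|q qPhi|y hy] := IH (option W) (opt_env b e)
    [set rename (@block_assoc n W) phi | phi in Phi].
- exact: not_embeds_option.
- have [q' q'Phi qq'] : exists2 q', (forall phi, phi \in q' -> Phi phi) &
      q = map (rename (@block_assoc n W)) q'.
    elim: q qPhi => [|psi q IHq] qPhi; first by exists [::].
    have [|q' q'Phi ->] := IHq.
      by move=> chi chiq; apply: qPhi; rewrite inE chiq orbT.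
    have [phi Pphi <-] := qPhi psi (mem_head _ _).
    by exists (phi :: q') => // chi; rewrite inE => /orP[/eqP ->|/q'Phi].
  have /satF[y hy] : sat (opt_env b set_val) (F q') by apply: bp; exists q'.
  exists y => psi; rewrite qq' => /mapP[phi phiq' ->].
  by rewrite sat_rename block_assoc_env; exact: hy.
- exists (ord_cons b y) => phi Pphi.
  by rewrite -block_assoc_env -sat_rename; apply: hy; exists phi.
Qed.

(** Homogeneity concerns maps on subsets, and [e] need not be injective: [c] chooses an index for
    each value, and preservation of equality formulas makes the choice harmless. *)
Lemma homogeneous_env (K : Type) (L : language) (S : structure L) :
  strongly_homogeneous K S ->
  forall (W : Type) (e e' : W -> S), ~ embeds K W ->
  (forall phi : formula L W, sat e phi <-> sat e' phi) ->
  exists2 s : S -> S, is_automorphism s & forall w, s (e w) = e' w.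
Proof.
move=> Khom W e e' KW ee'.
have /choice[c cP] : forall a : range e, exists w, e w = set_val a.
  by move=> a; have [w _ h] := set_mem (valP a); exists w.
have ceq : e \o c = set_val by apply/funext.
have [|s saut sP] := Khom _ (small_range KW) (e' \o c).
  by move=> phi; rewrite -sat_rename -ee' sat_rename ceq.
exists s => // w.
pose a : range e := exist _ (e w) (mem_set (imageT e w)).
rewrite (_ : e w = set_val a) // sP /=.
by have [+ _] := ee' (Eq (Var L (c a)) (Var L w)); apply; exact: (cP a).
Qed.

Lemma elementary_env (L : language) (M S : structure L) (j : M -> S) :
  elementary_embedding j -> forall V (e : V -> M) (phi : formula L V),
  sat e phi <-> sat (j \o e) phi.
Proof.
move=> jE V e phi; have := jE (rename e phi).
by rewrite !sat_rename.
Qed.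

(** * Definable sets of tuples of group elements *)

Section GroupDefinable.
Local Open Scope group_scope.
Context (L : language) (M S : structure L) (j : M -> S) (G : definable_group S).
Local Notation n := (ambient_dim G).

Definition genv (V : Type) (x : V -> G) : V * 'I_n + M -> S :=
  sum_env (fun p => coords (x p.1) p.2) j.

(** Definability over $M$ of relations between elements of $G$. [V] may be infinite, which allows
    small families of parameters. The closure lemmas below replace the writing of explicit
    formulas. *)
Definition gdef (V : Type) (D : set (V -> G)) : Prop :=
  exists phi : formula L (V * 'I_n + M), forall x, D x <-> sat (genv x) phi.

Lemma gdef_ext V (D E : set (V -> G)) :
  (forall x, D x <-> E x) -> gdef D -> gdef E.
Proof. by move=> DE [phi h]; exists phi => x; rewrite -h DE. Qed.

Lemma gdefC V (D : set (V -> G)) : gdef D -> gdef (fun x => ~ D x).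
Proof. by move=> [phi h]; exists (Not phi) => x; rewrite sat_Not h. Qed.

Lemma gdefI V (D E : set (V -> G)) : gdef D -> gdef E ->
  gdef (fun x => D x /\ E x).
Proof.
by move=> [phi h] [psi k]; exists (And phi psi) => x; rewrite sat_And h k.
Qed.

Lemma gdefT V : gdef (fun _ : V -> G => True).
Proof. by exists (Not Bot) => x; split=> // _ []. Qed.

Lemma gdef_reindex V W (f : V -> W) (D : set (V -> G)) :
  gdef D -> gdef (fun x : W -> G => D (x \o f)).
Proof.
move=> [phi h].
pose r (v : V * 'I_n + M) : W * 'I_n + M :=
  match v with inl p => inl (f p.1, p.2) | inr m => inr m end.
exists (rename r phi) => x; rewrite h sat_rename.
by rewrite (_ : genv x \o r = genv (x \o f)) //; apply/funext => -[].
Qed.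

Lemma gdef_mul V (u v w : V) : gdef (fun x : V -> G => x u * x v = x w).
Proof.
pose r (i : 'I_n + 'I_n + 'I_n) : V * 'I_n + M :=
  match i with
  | inl (inl i) => inl (u, i)
  | inl (inr i) => inl (v, i)
  | inr i => inl (w, i)
  end.
exists (rename r (mul_graph G)) => x; rewrite mul_graphP sat_rename.
by rewrite (_ : genv x \o r = sum_env (sum_env (coords (x u)) (coords (x v)))
  (coords (x w))) //; apply/funext => -[[]|].
Qed.

Definition gblock_var V (v : option V * 'I_n + M) : (V * 'I_n + M) + 'I_n :=
  match v with
  | inl (Some v, i) => inl (inl (v, i))
  | inl (None, i) => inr i
  | inr m => inl (inr m)
  end.

(** A quantifier over $G$ becomes a block of quantifiers over coordinates, relativized to
    [domain]. *)
Definition gblock V (phi : formula L (option V * 'I_n + M)) :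
    formula L ((V * 'I_n + M) + 'I_n) :=
  And (rename inr (domain G)) (rename (@gblock_var V) phi).

Lemma coords_domain (y : 'I_n -> S) :
  sat y (domain G) <-> exists g : G, coords g = y.
Proof.
have := range_coords G => /(congr1 (fun A : set _ => A y)) /= <-.
by split=> [[g _ <-]|[g <-]]; [exists g|exists g].
Qed.

Lemma gblockP V (x : V -> G) y phi :
  sat (sum_env (genv x) y) (gblock phi) <->
  exists2 b : G, coords b = y & sat (genv (opt_env b x)) phi.
Proof.
have E (b : G) : coords b = y ->
    sum_env (genv x) y \o @gblock_var V = genv (opt_env b x).
  by move=> <-; apply/funext => -[[[v|] i]|m].
rewrite sat_And !sat_rename (_ : _ \o inr = y) // coords_domain; split.
  by move=> [[b by_] h]; exists b => //; rewrite -(E b).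
by move=> [b by_ h]; split; [exists b|rewrite (E b)].
Qed.

Lemma gdef_ex V (D : set (option V -> G)) :
  gdef D -> gdef (fun x => exists b, D (opt_env b x)).
Proof.
move=> [phi h]; exists (Exs (gblock phi)) => x; rewrite sat_Exs; split.
  by move=> [b /h hb]; exists (coords b); apply/gblockP; exists b.
by move=> [y /gblockP[b _ hb]]; exists b; apply/h.
Qed.

Definition gfun (V : Type) (f : (V -> G) -> G) : Prop :=
  gdef (fun x : option V -> G => x None = f (x \o Some)).

Lemma gdef_subst V W (f : (W -> G) -> G) (r : V -> W) (D : set (option V -> G)) :
  gfun f -> gdef D -> gdef (fun x : W -> G => D (opt_env (f x) (x \o r))).
Proof.
move=> fd /(gdef_reindex (omap r)) Dd.
apply: gdef_ext (gdef_ex (gdefI fd Dd)) => x; rewrite /=.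
split=> [[b [-> ]]|h]; rewrite ?opt_env_omap //.
by exists (f x); rewrite opt_env_omap.
Qed.

(** Equality is expressed through multiplication: $bb=b$ forces $b=1$, and then $xb=y$ says
    $x=y$. *)
Lemma gfun_var V (v : V) : gfun (fun x => x v).
Proof.
have h : gdef (fun x : option (option V) -> G =>
    x None * x None = x None /\ x (Some None) * x None = x (Some (Some v))).
  by apply: gdefI; exact: gdef_mul.
apply: gdef_ext (gdef_ex h) => x /=; split.
  by move=> [b [/(congr1 (fun y => b^-1 * y))]]; rewrite mulKg mulVg => ->;
    rewrite mulg1.
by move=> ->; exists 1; rewrite !mulg1.
Qed.

Lemma gfun_mul V (f g : (V -> G) -> G) :
  gfun f -> gfun g -> gfun (fun x => f x * g x).
Proof.
move=> fd gd.
have h : gdef (fun x : option (option (option V)) -> G =>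
    [/\ x None = f (x \o (Some \o Some \o Some)),
        x (Some None) = g (x \o (Some \o Some \o Some)) &
        x None * x (Some None) = x (Some (Some None))]).
  have h1 := gdef_reindex (fun v => if v is Some v then Some (Some (Some v))
    else None) fd.
  have h2 := gdef_reindex (fun v => if v is Some v then Some (Some (Some v))
    else Some None) gd.
  apply: gdef_ext (gdefI h1 (gdefI h2 (gdef_mul None (Some None) (Some (Some None))))).
  by move=> x; split=> [[? []] //|[]].
apply: gdef_ext (gdef_ex (gdef_ex h)) => x /=; split.
  by move=> [b [c [/= <- <- <-]]].
by move=> ->; exists (g (x \o Some)), (f (x \o Some)).
Qed.

Lemma gfun_inv V (f : (V -> G) -> G) : gfun f -> gfun (fun x => (f x)^-1).
Proof.
move=> fd.
have h : gdef (fun x : option (option (option V)) -> G =>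
    [/\ x None * x None = x None,
        x (Some None) = f (x \o (Some \o Some \o Some)) &
        x (Some (Some None)) * x (Some None) = x None]).
  have h1 := gdef_reindex (fun v => if v is Some v then Some (Some (Some v))
    else Some None) fd.
  apply: gdef_ext (gdefI (gdef_mul None None None)
    (gdefI h1 (gdef_mul (Some (Some None)) (Some None) None))).
  by move=> x; split=> [[? []] //|[]].
apply: gdef_ext (gdef_ex (gdef_ex h)) => x /=; split.
  move=> [b [c [/= cc -> bc]]].
  have c1 : c = 1 by apply: (mulgI c); rewrite mulg1.
  by apply: (mulIg (f (x \o Some))); rewrite mulVg -c1.
by move=> ->; exists (f (x \o Some)), 1; rewrite mulg1 mulVg.
Qed.

End GroupDefinable.

Local Open Scope group_scope.

(** * Sets of group elements definable or type-definable over $M$ *)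

Section ParameterDefinable.
Context (L : language) (M S : structure L) (j : M -> S) (G : definable_group S).
Local Notation n := (ambient_dim G).
Local Notation gdef := (@gdef L M S j G).
Local Notation gfun := (@gfun L M S j G).
Local Notation gvar := (@gfun_var L M S j G _).

Definition mdef (D : set G) : Prop := gdef (fun x : unit -> G => D (x tt)).

(** Type-definability over $M$ (see [closed_overP]), phrased with definable supersets to keep
    formulas out of the compactness arguments. *)
Definition closed_over (A : set G) : Prop :=
  forall a, (forall D, mdef D -> A `<=` D -> D a) -> A a.

Lemma gdef_mem V (D : set G) (f : (V -> G) -> G) :
  mdef D -> gfun f -> gdef (fun x => D (f x)).
Proof.
move=> /(gdef_reindex (fun _ : unit => None : option V)) Dd fd.
exact: (gdef_subst id fd Dd).
Qed.

Lemma gfun_const V (g : G) : group_points j G g -> gfun (fun _ : V -> G => g).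
Proof.
move=> [y _ gy].
pose phi : formula L (option V * 'I_n + M) :=
  conjunction [seq Eq (Var L (inl (None, i))) (Var L (inr (y i))) | i <- enum 'I_n].
exists phi => x; rewrite /phi sat_conjunction; split.
  by move=> xg _ /mapP[i _ ->] /=; rewrite xg gy.
move=> h; apply: (@coords_inj _ _ G); apply/funext => i; rewrite gy.
by apply: (h (Eq (Var L (inl (None, i))) (Var L (inr (y i))))); rewrite map_f ?mem_enum.
Qed.

Lemma mdefP (D : set G) : mdef D <-> exists phi, D = [set g | tp j g phi].
Proof.
pose r (v : unit * 'I_n + M) : 'I_n + M :=
  match v with inl p => inl p.2 | inr m => inr m end.
pose r' (v : 'I_n + M) : unit * 'I_n + M :=
  match v with inl p => inl (tt, p) | inr m => inr m end.
split=> [[phi h]|[phi ->]].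
  exists (rename r phi); apply/seteqP; split=> g;
    rewrite /= /tp /= sat_rename (_ : _ \o r = genv j (fun=> g)) -?h //;
    by apply/funext => -[].
exists (rename r' phi) => x; rewrite sat_rename (_ : _ \o r' = sum_env (coords (x tt)) j) //.
by apply/funext => -[].
Qed.

Lemma mdef_tp phi : mdef [set g : G | tp j g phi].
Proof. by apply/mdefP; exists phi. Qed.

Lemma mdefC D : mdef D -> mdef (~` D).
Proof. exact: gdefC. Qed.

Lemma mdefI D E : mdef D -> mdef E -> mdef (D `&` E).
Proof. exact: gdefI. Qed.

Lemma mdefT : mdef setT.
Proof. exact: gdefT. Qed.

Lemma mdef_inv D : mdef D -> mdef [set g | D g^-1].
Proof. by move=> Dd; apply: gdef_ext (gdef_mem Dd (gfun_inv (gvar tt))). Qed.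

Lemma mdef_prod D E : mdef D -> mdef E -> mdef (prod_set D E).
Proof.
move=> Dd Ed.
have := gdef_ex (gdefI (gdef_mem Dd (gvar None))
  (gdef_mem Ed (gfun_mul (gfun_inv (gvar None)) (gvar (Some tt))))).
apply: gdef_ext => x /=; split.
  by move=> [b [Db Eb]]; exists b => //; exists (b^-1 * x tt) => //; rewrite mulVKg.
by move=> [b Db [c Ec <-]]; exists b; rewrite mulKg.
Qed.

Lemma mdef_lmul g D : group_points j G g -> mdef D -> mdef [set h | D (g * h)].
Proof.
move=> gM Dd.
by apply: gdef_ext (gdef_mem Dd (gfun_mul (gfun_const unit gM) (gvar tt))).
Qed.

Lemma mdef_rmul g D : group_points j G g -> mdef D -> mdef [set h | D (h * g)].
Proof.
move=> gM Dd.
by apply: gdef_ext (gdef_mem Dd (gfun_mul (gvar tt) (gfun_const unit gM))).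
Qed.

Lemma tp_eqP (a b : G) :
  tp j a = tp j b <-> forall D, mdef D -> D a -> D b.
Proof.
split=> [ab D /mdefP[phi ->] /=|h]; first by rewrite ab.
apply/seteqP; split=> phi; first exact: h (mdef_tp phi).
by apply: contraPP => nphi; exact: h (mdefC (mdef_tp phi)) nphi.
Qed.

Lemma closed_overP (A : set G) : closed_over A <-> type_definable j A.
Proof.
split=> [Ac|[p ->] a h phi pphi]; last first.
  by apply: (h _ (mdef_tp phi)) => g; apply.
exists [set phi | A `<=` [set g | tp j g phi]].
apply/seteqP; split=> [a Aa phi /(_ _ Aa) //|a h].
by apply: Ac => D /mdefP[phi ->]; exact: h.
Qed.

Lemma mdef_closed D : mdef D -> closed_over D.
Proof. by move=> Dd a; apply. Qed.

Lemma closed_tp (A : set G) a b :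
  closed_over A -> tp j a = tp j b -> A a -> A b.
Proof.
by move=> Ac /tp_eqP ab Aa; apply: Ac => D Dd AD; apply: ab => //; exact: AD.
Qed.

Lemma closed_overI (A B : set G) :
  closed_over A -> closed_over B -> closed_over (A `&` B).
Proof.
move=> Ac Bc a h; split.
  by apply: Ac => D Dd AD; apply: h => // g [/AD].
by apply: Bc => D Dd AD; apply: h => // g [_ /AD].
Qed.

Lemma closed_overU (A B : set G) :
  closed_over A -> closed_over B -> closed_over (A `|` B).
Proof.
move=> Ac Bc a h; apply: contrapT => /not_orP[/(contra_not (Ac a)) nA /(contra_not (Bc a)) nB].
have [D Dd [AD nDa]] : exists2 D, mdef D & A `<=` D /\ ~ D a.
  by apply: contrapT => k; apply: nA => D Dd AD; apply: contrapT => nDa;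
    apply: k; exists D.
have [E Ed [BE nEa]] : exists2 E, mdef E & B `<=` E /\ ~ E a.
  by apply: contrapT => k; apply: nB => D' Dd' AD'; apply: contrapT => nDa';
    apply: k; exists D'.
have [] := h (~` (~` D `&` ~` E)).
- by apply/mdefC/mdefI; exact: mdefC.
- by move=> g [/AD Dg [nDg _]|/BE Eg [_ nEg]]; [exact: nDg|exact: nEg].
- by [].
Qed.

Lemma closed_inv (A : set G) :
  closed_over A -> closed_over [set g | A g^-1].
Proof.
move=> Ac a h; apply: Ac => D Dd AD.
by apply: (h [set g | D g^-1] (mdef_inv Dd)) => g; exact: AD.
Qed.

Lemma closed_lmul g (A : set G) : group_points j G g ->
  closed_over A -> closed_over [set h | A (g * h)].
Proof.
move=> gM Ac a h; apply: Ac => D Dd AD.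
by apply: (h [set h | D (g * h)] (mdef_lmul gM Dd)) => k; exact: AD.
Qed.

(** * Saturation, elementarity and homogeneity for $G$ *)

Section Monster.
Context (K : Type) (hS : monster_model K j).

(** Every language has infinitely many formulas, for instance those obtained from $\bot$ by
    iterating $\phi\mapsto(\phi\to\phi)$, so the second clause of [monster_model] makes $K$
    uncountable. *)
Lemma not_embeds_nat : ~ embeds K nat.
Proof.
have [_ /smallTP hK _ _] := hS; apply: contra_not hK => Knat.
apply: embeds_trans Knat _.
exists (fun k => [set iter k (fun phi => Imp phi phi) Bot : formula L M]).
move=> k l /(congr1 (fun A : set _ => A (iter k (fun phi => Imp phi phi) Bot))) /= e.
have {e} : iter k (fun phi => Imp phi phi) Bot = iter l (fun phi => Imp phi phi) Bot :> formula L M.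
  by rewrite -e.
by elim: k l => [|k IH] [|l] //= [/IH ->].
Qed.

Lemma not_embeds_model : ~ embeds K M.
Proof.
have [_ /smallTP hK _ _] := hS; apply: contra_not hK => KM.
apply: embeds_trans KM _.
exists (fun m => [set Eq (Var L m) (Var L m)]).
move=> m m' /(congr1 (fun A : set _ => A (Eq (Var L m) (Var L m)))) /= e.
have : Eq (Var L m) (Var L m) = Eq (Var L m') (Var L m') by rewrite -e.
by case.
Qed.

Lemma not_embeds_vars V : ~ embeds K V -> ~ embeds K (V * 'I_n + M).
Proof.
move=> KV; apply: not_embeds_sum; [exact: not_embeds_nat| |exact: not_embeds_model].
exact: not_embeds_prod_ord not_embeds_nat KV.
Qed.

Lemma not_embeds_unit : ~ embeds K unit.
Proof.
move=> Ku; apply/not_embeds_nat/(embeds_trans Ku).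
by exists (fun=> 0%N) => -[] [].
Qed.

Lemma not_embeds_bool : ~ embeds K bool.
Proof.
move=> Ku; apply/not_embeds_nat/(embeds_trans Ku).
by exists nat_of_bool => -[] [].
Qed.

(** Directedness takes the place of finite intersections, and the relativization to [domain] ensures
    that the realized tuple is an element of $G$. *)
Lemma gdef_saturated V (x : V -> G) I (D : I -> set (option V -> G)) :
  ~ embeds K V -> inhabited I -> (forall i, gdef (D i)) ->
  (forall i k, exists l, forall y, D l y -> D i y /\ D k y) ->
  (forall i, exists b, D i (opt_env b x)) ->
  exists b, forall i, D i (opt_env b x).
Proof.
move=> KV [i0] Dd dir ne.
have [phi phiP] := choice Dd.
pose Phi := [set gblock (phi i) | i in setT].
have [_ _ hsat _] := hS.
have [q qPhi|y hy] := saturated_block not_embeds_nat hsat (Phi := Phi) (e := genv j x)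
  (not_embeds_vars KV).
  have [l hl] : exists l, forall b, D l (opt_env b x) -> forall psi, psi \in q ->
      sat (sum_env (genv j x) (coords b)) psi.
    elim: q qPhi => [|psi q IH] qPhi; first by exists i0 => b _ psi; rewrite in_nil.
    have [|l hl] := IH.
      by move=> chi chiq; apply: qPhi; rewrite inE chiq orbT.
    have [k _ kpsi] := qPhi psi (mem_head _ _).
    have [m hm] := dir l k; exists m => b /hm[Dl Dk] chi.
    rewrite inE => /orP[/eqP ->|]; last exact: hl.
    by rewrite -kpsi; apply/gblockP; exists b => //; apply/phiP.
  by have [b Db] := ne l; exists (coords b); exact: hl.
have hyi i : sat (sum_env (genv j x) y) (gblock (phi i)) by apply: hy; exists i.
have [b by_ _] := (gblockP j x y (phi i0)).1 (hyi i0).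
exists b => i; apply/phiP.
have [b' b'y h] := (gblockP j x y (phi i)).1 (hyi i).
by rewrite (_ : b = b') //; apply: (@coords_inj _ _ G); rewrite b'y.
Qed.

(** Tarski-Vaught: the parameters come from tuples of $M$, so elementarity brings the existential
    formula down to $M$ and its witness back up. *)
Lemma gdef_witness V (x : V -> G) (D : set (option V -> G)) :
  (forall v, group_points j G (x v)) -> gdef D ->
  (exists b, D (opt_env b x)) ->
  exists2 b, group_points j G b & D (opt_env b x).
Proof.
have [jE _ _ _] := hS => xM [phi phiP] [b0 /phiP Db0].
have /choice[e0 e0P] : forall v, exists e : 'I_n -> M, coords (x v) = j \o e.
  by move=> v; have [e _ ->] := xM v; exists e.
pose e : V * 'I_n + M -> M := sum_env (fun p => e0 p.1 p.2) id.
have eE : genv j x = j \o e.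
  by apply/funext => -[[v i]|m] //=; rewrite e0P.
have : sat (genv j x) (Exs (gblock phi)).
  by apply/sat_Exs; exists (coords b0); apply/gblockP; exists b0.
rewrite eE -(elementary_env jE) => /sat_Exs[y].
rewrite (elementary_env jE) (_ : j \o _ = sum_env (genv j x) (j \o y)); last first.
  by rewrite eE; apply/funext => -[].
move=> /gblockP[b by_ hb]; exists b; last exact/phiP.
exists y => //; rewrite (elementary_env jE); apply/coords_domain.
by exists b.
Qed.

Lemma mdef_witness D : mdef D -> D !=set0 -> exists2 g, group_points j G g & D g.
Proof.
move=> Dd [a Da].
(* No parameters are present; indexing them by [void] makes the condition on them vacuous. *)
have Dd' := gdef_reindex (fun _ : unit => None : option void) Dd.
have xM (v : void) : group_points j G 1 by case: v.
have [|b bM Db] := gdef_witness (x := fun=> 1) xM Dd'; first by exists a.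
by exists b.
Qed.

Lemma homogeneous_group V (x y : V -> G) : ~ embeds K V ->
  (forall D, gdef D -> D x -> D y) ->
  exists2 s, automorphism_over j s &
    forall v, coords (y v) = s \o coords (x v).
Proof.
move=> KV xy; have [_ _ _ hhom] := hS.
have [phi|s saut sP] := homogeneous_env hhom (e := genv j x) (e' := genv j y)
  (not_embeds_vars KV).
  split=> [|]; first by apply: (xy [set z | sat (genv j z) phi]); exists phi.
  apply: contraPP => nphi.
  by apply: (xy [set z | ~ sat (genv j z) phi]) => //; apply: gdefC; exists phi.
exists s.
  by split=> //; apply/funext => m; exact: (sP (inr m)).
by move=> v; apply/funext => i; apply/esym; exact: (sP (inl (v, i))).
Qed.

Lemma aut_mul s (a b c a' b' c' : G) : is_automorphism s -> a * b = c ->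
  coords a' = s \o coords a -> coords b' = s \o coords b ->
  coords c' = s \o coords c -> a' * b' = c'.
Proof.
move=> sa /mul_graphP abc a'E b'E c'E; apply/mul_graphP.
rewrite a'E b'E c'E; move: abc; rewrite (sat_aut _ _ sa).
by rewrite (_ : s \o _ = sum_env (sum_env (s \o coords a) (s \o coords b)) (s \o coords c)) //;
  apply/funext => -[[]|].
Qed.

Lemma aut_lift s (a : G) : is_automorphism s ->
  exists a' : G, coords a' = s \o coords a.
Proof.
move=> sa; apply/coords_domain; rewrite -(sat_aut _ _ sa).
by apply/coords_domain; exists a.
Qed.

Lemma tp_aut s (a b : G) : automorphism_over j s -> coords b = s \o coords a ->
  tp j a = tp j b.
Proof.
move=> [sa sj] ba; have E : sum_env (coords b) j = s \o sum_env (coords a) j.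
  by apply/funext => -[i|m] /=; [rewrite ba|rewrite -[in LHS]sj].
by apply/seteqP; split=> phi; rewrite /tp /= E -(sat_aut _ _ sa).
Qed.

(** Members of a proper filter have the finite intersection property, so saturation applies. If [U]
    is an ultrafilter containing $G(M)$, then [c] realizes over $M$ and [x] a type finitely
    satisfiable in $G(M)$. *)
Lemma realize_filter V (x : V -> G) (U : set_system G) : ~ embeds K V ->
  ProperFilter U -> exists c, forall D : set (option V -> G), gdef D ->
    U [set g | D (opt_env g x)] -> D (opt_env c x).
Proof.
move=> KV UF.
pose I := {D : set (option V -> G) | gdef D /\ U [set g | D (opt_env g x)]}.
have [||D E|[D [Dd DU]]|b hb] :=
  gdef_saturated (x := x) (D := fun i : I => sval i) KV.
- by constructor; exists setT; split; [exact: gdefT|exact: filterT].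
- by case=> D [].
- case: D E => D [Dd DU] [E [Ed EU]].
  have DE : gdef (fun y => D y /\ E y) /\ U [set g | D (opt_env g x) /\ E (opt_env g x)].
    by split; [exact: gdefI|exact: filterI].
  by exists (exist (fun D => gdef D /\ U [set g | D (opt_env g x)])
    (fun y => D y /\ E y) DE : I).
- by have [b Db] := filter_ex DU; exists b.
- by exists b => D Dd DU; exact: (hb (exist _ D (conj Dd DU))).
Qed.

(** The definable sets containing $a$ meet $G(M)$ by elementarity, so their traces generate a proper
    filter. The ultrafilter [U] encodes a global coheir of $\mathrm{tp}(a/M)$. *)
Lemma ultrafilter_of_type (a : G) : exists2 U : set_system G, UltraFilter U &
  U (group_points j G) /\ forall D, mdef D -> D a -> U D.
Proof.
pose F := filter_from [set D | mdef D /\ D a] (fun D => D `&` group_points j G).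
have FF : ProperFilter F.
  apply: filter_from_proper; last first.
    move=> D [Dd Da]; have [|g gM Dg] := mdef_witness Dd; first by exists a.
    by exists g.
  apply: filter_from_filter; first by exists setT; split=> //; exact: mdefT.
  move=> D E [Dd Da] [Ed Ea]; exists (D `&` E).
    by split=> //; exact: mdefI.
  by move=> g [[]].
have [U [UU FU]] := ultraFilterLemma FF.
exists U => //; split.
  by apply: FU; exists setT; [split=> //; exact: mdefT|move=> g []].
by move=> D Dd Da; apply: FU; exists D => // g [].
Qed.

End Monster.
End ParameterDefinable.

(** * The subgroup generated by the ratios of elements of the same type *)

Section SetPowers.
Context (G : groupType).
Implicit Types (A B : set G).

Fixpoint set_pow A k : set G :=
  if k is k'.+1 then prod_set A (set_pow A k') else [set 1].

Lemma prod_setS A A' B B' :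
  A `<=` A' -> B `<=` B' -> prod_set A B `<=` prod_set A' B'.
Proof.
by move=> AA' BB' _ [a Aa [b Bb <-]]; exists a; [exact: AA'|exists b; [exact: BB'|]].
Qed.

Lemma mem_prod_set A B a b : A a -> B b -> prod_set A B (a * b).
Proof. by move=> Aa Bb; exists a => //; exists b. Qed.

Lemma set_powS A B k : A `<=` B -> set_pow A k `<=` set_pow B k.
Proof. by move=> AB; elim: k => //= k IH; exact: prod_setS. Qed.

Lemma set_powM A k l x y :
  set_pow A k x -> set_pow A l y -> set_pow A (k + l) (x * y).
Proof.
elim: k x => [|k IH] x /=; first by move=> -> ; rewrite mul1g.
move=> [a Aa [b Ab <-]] Ay; rewrite -mulgA.
by apply: mem_prod_set => //; exact: IH.
Qed.

Lemma set_pow1 A a : A a -> set_pow A 1 a.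
Proof. by move=> Aa; rewrite -[a]mulg1; exact: mem_prod_set. Qed.

Lemma set_powV A k x : (forall a, A a -> A a^-1) ->
  set_pow A k x -> set_pow A k x^-1.
Proof.
move=> AV; elim: k x => [|k IH] x /=; first by move=> ->; rewrite invg1.
move=> [a Aa [b Ab <-]]; rewrite invgM.
by have := set_powM (IH _ Ab) (set_pow1 (AV _ Aa)); rewrite addn1.
Qed.

Definition set_span A : set G := [set g | exists k, set_pow A k g].

Lemma set_span_subgroup A : (forall a, A a -> A a^-1) -> is_subgroup (set_span A).
Proof.
move=> AV; split; first by exists 0%N.
  by move=> x y [k xk] [l yl]; exists (k + l)%N; exact: set_powM.
by move=> x [k xk]; exists k; exact: set_powV.
Qed.

Lemma sub_set_span A : A `<=` set_span A.
Proof. by move=> a Aa; exists 1%N; exact: set_pow1. Qed.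

Lemma set_span_min A (K : set G) : is_subgroup K -> A `<=` K -> set_span A `<=` K.
Proof.
move=> [K1 KM _] AK x [k]; elim: k x => [|k IH] x /=; first by move=> ->.
by move=> [a Aa [b Ab <-]]; apply: KM; [exact: AK|exact: IH].
Qed.

End SetPowers.

(** * Coheirs, ratios of elements of the same type, and the closure of their span *)

Section Ratios.
Context (L : language) (M S : structure L) (j : M -> S) (G : definable_group S).
Local Notation gdef := (@gdef L M S j G).
Local Notation gfun := (@gfun L M S j G).
Local Notation gvar := (@gfun_var L M S j G _).
Local Notation mdef := (@mdef L M S j G).
Local Notation closed_over := (@closed_over L M S j G).
Local Notation tp := (@tp L M S j G).
Context (K : Type) (hS : monster_model K j).

Definition tp_ratio : set G := [set g | exists a b, tp a = tp b /\ g = a^-1 * b].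

Local Notation X := tp_ratio.
Local Notation Z := (set_span X).

Lemma tp_ratio1 : X 1.
Proof. by exists 1, 1; rewrite invg1 mulg1. Qed.

Lemma tp_ratioV g : X g -> X g^-1.
Proof. by move=> [a [b [ab ->]]]; exists b, a; rewrite invgM invgK. Qed.

Lemma tp_span_subgroup : is_subgroup Z.
Proof. exact: set_span_subgroup tp_ratioV. Qed.

Definition realizes (V : Type) (U : set_system G) (x : V -> G) (c : G) : Prop :=
  forall D : set (option V -> G), gdef D -> U [set g | D (opt_env g x)] ->
    D (opt_env c x).

Lemma realizes1 V U (x : V -> G) c v :
  realizes U x c -> realizes U (fun _ : unit => x v) c.
Proof.
move=> h D Dd UD.
have := h _ (gdef_reindex (omap (fun=> v)) Dd); rewrite /= opt_env_omap.
by apply; rewrite (_ : [set g | _] = [set g | D (opt_env g (fun _ : unit => x v))]) //;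
  apply/seteqP; split=> g /=; rewrite opt_env_omap.
Qed.

Lemma realizes_type V (U : set_system G) (x : V -> G) c a :
  (forall D, mdef D -> D a -> U D) -> realizes U x c -> tp a = tp c.
Proof.
move=> Ua h; apply/tp_eqP => D Dd Da.
exact: (h _ (gdef_reindex (fun=> None) Dd) (Ua _ Dd Da)).
Qed.

(* The coheir property: a type finitely satisfiable in G(M) has the same trace
   over parameters of the same type. *)
Lemma coheir_transfer (U : set_system G) a b c d :
  UltraFilter U -> U (group_points j G) -> tp a = tp b ->
  realizes U (fun _ : unit => a) c -> realizes U (fun _ : unit => b) d ->
  forall D : set (option unit -> G), gdef D ->
    D (opt_env c (fun=> a)) -> D (opt_env d (fun=> b)).
Proof.
move=> UU UM ab ca db D Dd Dc; apply: contrapT => nDd.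
have [UD|UD] := in_ultra_setVsetC [set g | D (opt_env g (fun=> a))] UU; last first.
  exact: (ca _ (gdefC Dd) UD).
have [UE|UE] := in_ultra_setVsetC [set g | D (opt_env g (fun=> b))] UU.
  exact: nDd (db _ Dd UE).
have [g [gM [Da nDb]]] := filter_ex (filterI UM (filterI UD UE)).
apply: nDb.
have Dg : mdef [set y | D (opt_env g (fun=> y))].
  have := gdef_subst (fun=> tt) (gfun_const unit gM) Dd.
  by apply: gdef_ext => x; rewrite (_ : x \o _ = fun=> x tt) //; apply/funext => -[].
by move/tp_eqP: ab => /(_ _ Dg); apply.
Qed.

(* A coheir of tp(a) realized over representatives of all the cosets of H that
   meet tp(a) lies in one of these cosets; homogeneity moves the representative to
   any other realization of tp(a). *)
Lemma tp_ratio_sub (H : set G) : is_subgroup H -> aut_invariant j H ->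
  bounded_index K H -> X `<=` H.
Proof.
move=> [H1 HM HV] Hinv Hb _ [a [b [ab ->]]].
have [U UU [UM Ua]] := ultrafilter_of_type hS a.
pose T := {C : set G | exists t, tp t = tp a /\ C = left_coset H t}.
(* Bounded index leaves fewer than $|K|$ cosets, so the coheir can be realized over all their
   representatives at once. *)
have KT : ~ embeds K T.
  move=> [f fI]; apply: Hb; apply/card_le_setTP.
  exists (fun k => sval (f k)).
    by move=> x y; case: (f x) (f y) (@fI x y) => [C hC] [C' hC'] /= h e;
      apply: h; exact: eq_exist.
  by move=> k; case: (f k) => C [t [ta CE]]; exists t => /=.
have /choice[r rP] : forall C : T, exists t, tp t = tp a /\ sval C = left_coset H t.
  by move=> [C [t h]]; exists t.
have [c cr] := realize_filter hS r KT (@ultra_proper _ _ UU).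
have ac := realizes_type Ua cr.
pose C : T := exist _ (left_coset H c) (ex_intro _ c (conj (esym ac) erefl)).
have Hrc : H ((r C)^-1 * c).
  have [_ CE] := rP C.
  have : left_coset H c c by exists 1; rewrite ?mulg1.
  by rewrite [left_coset H c]CE => -[h Hh <-]; rewrite mulKg.
have key a' c' : tp a = tp a' -> realizes U (fun _ : unit => a') c' -> H (a'^-1 * c').
  move=> aa' c'a'; have [ra _] := rP C.
  pose x v := if v then r C else c; pose y v := if v then a' else c'.
  have [D Dd Dx|s [sa sj] sP] := homogeneous_group hS (x := x) (y := y) (not_embeds_bool hS).
    have := coheir_transfer UU UM (etrans ra aa') (realizes1 (v := C) cr) c'a'
      (gdef_reindex (fun v : bool => if v then Some tt else None) Dd).
    have E u v : opt_env u (fun _ : unit => v) \o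
        (fun w : bool => if w then Some tt else None) = fun w => if w then v else u.
      by apply/funext => -[].
    by rewrite !E; apply.
  have [g gE] := aut_lift ((r C)^-1 * c) sa.
  have <- : a' * g = c' := aut_mul sa (mulVKg (r C) c) (sP true) gE (sP false).
  rewrite mulKg.
  by rewrite -(Hinv s) //; exists ((r C)^-1 * c).
(* One realization $c'$ over both $a$ and $b$ writes $a^{-1}b$ as a product of two elements of
   $H$. *)
have [c' c'r] := realize_filter hS (fun v : bool => if v then a else b)
  (not_embeds_bool hS) (@ultra_proper _ _ UU).
have Ha := key _ _ erefl (realizes1 (v := true) c'r).
have Hb' := key _ _ ab (realizes1 (v := false) c'r).
have -> : a^-1 * b = (a^-1 * c') * (b^-1 * c')^-1.
  by rewrite invgM invgK mulgA mulgK.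
by apply: HM => //; exact: HV.
Qed.

(** To conjugate $a^{-1}b$ by $c$, let $d$ realize over $a,b$ a coheir of the type of $c$. Then $ad$
    and $bd$ have the same type, so $d^{-1}(a^{-1}b)d$ is again a ratio, and $d^{-1}c$ is a ratio
    too. *)
Lemma tp_span_normal c g : Z g -> Z (c^-1 * g * c).
Proof.
have [Z1 ZM ZV] := tp_span_subgroup.
have XZ c' a b : tp a = tp b -> Z (c'^-1 * (a^-1 * b) * c').
  move=> ab; have [U UU [UM Uc]] := ultrafilter_of_type hS c'.
  have [d dr] := realize_filter hS (fun v : bool => if v then a else b)
    (not_embeds_bool hS) (@ultra_proper _ _ UU).
  have adbd : tp (a * d) = tp (b * d).
    apply/tp_eqP => D Dd.
    exact: (coheir_transfer UU UM ab (realizes1 (v := true) dr) (realizes1 (v := false) dr)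
      (gdef_mem Dd (gfun_mul (gvar (Some tt)) (gvar None)))).
  have cd : Z (d^-1 * c').
    apply: sub_set_span; exists d, c'; split=> //.
    exact/esym/(realizes_type Uc dr).
  have -> : c'^-1 * (a^-1 * b) * c' =
      (d^-1 * c')^-1 * ((a * d)^-1 * (b * d)) * (d^-1 * c').
    by rewrite !invgM invgK !mulgA !mulgK.
  apply: (ZM _ _ _ cd); apply: (ZM _ _ (ZV _ cd)).
  by apply: sub_set_span; exists (a * d), (b * d).
move=> [k]; elim: k g => [|k IH] g /=; first by move=> ->; rewrite mulg1 mulVg.
move=> [_ [a [b [ab ->]]] [y yk <-]].
have -> : c^-1 * (a^-1 * b * y) * c = (c^-1 * (a^-1 * b) * c) * (c^-1 * y * c).
  by rewrite !mulgA mulgK.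
by apply: ZM; [exact: XZ|exact: IH].
Qed.

Definition mdef_above (A : set G) : set (set G) := [set D | mdef D /\ A `<=` D].

Lemma mdef_aboveT A : mdef_above A setT.
Proof. by split=> //; exact: mdefT. Qed.

Lemma mdef_aboveI A D E : mdef_above A D -> mdef_above A E -> mdef_above A (D `&` E).
Proof.
move=> [Dd AD] [Ed AE]; split; first exact: mdefI.
by move=> g Ag; split; [exact: AD|exact: AE].
Qed.

(** Definable sets above $A$, and likewise above $B$, are closed under intersection, so the
    conditions form a directed family. This is the form of compactness used for products and
    closures. *)
Lemma saturated_above (A B : set G) (y : G) (f g : (option unit -> G) -> G) :
  gfun f -> gfun g ->
  (forall D E, mdef_above A D -> mdef_above B E ->
    exists b, D (f (opt_env b (fun=> y))) /\ E (g (opt_env b (fun=> y)))) ->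
  exists b, (forall D, mdef_above A D -> D (f (opt_env b (fun=> y)))) /\
    (forall E, mdef_above B E -> E (g (opt_env b (fun=> y)))).
Proof.
move=> fd gd ne.
pose I := ({D | mdef_above A D} * {E | mdef_above B E})%type.
pose mkI D (AD : mdef_above A D) E (BE : mdef_above B E) : I :=
  (exist _ D AD, exist _ E BE).
pose F (i : I) (x : option unit -> G) := sval i.1 (f x) /\ sval i.2 (g x).
have [|||[[P hP] [Q hQ]]|b bP] :=
    gdef_saturated hS (x := fun _ : unit => y) (D := F) (not_embeds_unit hS).
- by constructor; exact: mkI (mdef_aboveT A) _ (mdef_aboveT B).
- by move=> [[P [Pd AP]] [Q [Qd BQ]]]; apply: gdefI; exact: gdef_mem.
- move=> [[P hP] [Q hQ]] [[P' hP'] [Q' hQ']].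
  by exists (mkI _ (mdef_aboveI hP hP') _ (mdef_aboveI hQ hQ')) => z [[? ?] [? ?]].
- exact: ne.
- exists b; split=> [D AD|E BE].
    by have [] := bP (mkI _ AD _ (mdef_aboveT B)).
  by have [] := bP (mkI _ (mdef_aboveT A) _ BE).
Qed.

(** Compactness: the factorizations $y=b\cdot b^{-1}y$ through definable sets above $A$ and $B$ are
    realized by a single $b$. *)
Lemma closed_prod (A B : set G) :
  closed_over A -> closed_over B -> closed_over (prod_set A B).
Proof.
move=> Ac Bc y hy.
have [P Q [Pd AP] [Qd BQ]|b [bA bB]] := saturated_above (A := A) (B := B) (y := y)
    (gvar None) (gfun_mul (gfun_inv (gvar None)) (gvar (Some tt))).
  have [|a Pa [b Qb <-]] := hy _ (mdef_prod Pd Qd); first exact: prod_setS.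
  by exists a; rewrite /= mulKg.
exists b; first by apply: Ac => P Pd AP; exact: bA.
exists (b^-1 * y); last by rewrite mulVKg.
by apply: Bc => Q Qd BQ; exact: (bB Q).
Qed.

Lemma group_points1 : group_points j G 1.
Proof.
have h : mdef [set g | g * g = g].
  by apply: gdef_ext (@gdef_mul L M S j G unit tt tt tt).
have [|g gM /= gg] := mdef_witness hS h; first by exists 1; rewrite /= mulg1.
by rewrite (_ : 1 = g) //; apply: (mulgI g); rewrite mulg1.
Qed.

Lemma mdef1 (g : G) : group_points j G g -> mdef [set g].
Proof.
move=> gM.
have h : gdef (fun x : option unit -> G => x None = g /\ x None = x (Some tt)).
  by apply: gdefI; [exact: gfun_const gM|exact: (gvar tt)].
by apply: gdef_ext (gdef_ex h) => x /=; split=> [[b [-> <-]] //|->]; exists g.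
Qed.

Lemma closed_set_pow (A : set G) k : closed_over A -> closed_over (set_pow A k).
Proof.
move=> Ac; elim: k => [|k IH] /=; last exact: closed_prod.
exact: mdef_closed (mdef1 group_points1).
Qed.

(** That $b$ and $by$ have the same type is a conjunction of conditions on finite lists of definable
    sets. Each of these is satisfiable for $y$ in all definable sets above $X$. *)
Lemma closed_tp_ratio : closed_over X.
Proof.
move=> y hy.
pose I := seq {P : set G | mdef P}.
pose D (q : I) (x : option unit -> G) := forall P, List.In P q ->
  (sval P (x None) <-> sval P (x None * x (Some tt))).
have Dd q : gdef (D q).
  elim: q => [|[P Pd] q IH]; first by apply: gdef_ext (gdefT j G _) => x; split=> // _ P [].
  have P1 := gdef_mem Pd (gvar (None : option unit)).
  have P2 := gdef_mem Pd (gfun_mul (gvar (None : option unit)) (gvar (Some tt))).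
  have := gdefI IH (gdefI (gdefC (gdefI P1 (gdefC P2))) (gdefC (gdefI P2 (gdefC P1)))).
  apply: gdef_ext => x; split.
    move=> [h [h1 h2]] Q /= [<-|/h //] /=.
    by split=> ?; apply: contrapT => ?; [apply: h1|apply: h2].
  move=> h; split; first by move=> Q Qq; apply: h; right.
  by have [/= k l] := h _ (or_introl erefl); split=> -[? n]; apply: n; [exact: k|exact: l].
have [|//|q r|q|b bP] :=
    gdef_saturated hS (x := fun _ : unit => y) (D := D) (not_embeds_unit hS).
- by constructor; exact: [::].
- exists (q ++ r) => z h; split=> P Pq; apply: h; apply/List.in_app_iff; [by left|by right].
- have /gdef_ex Eq := Dd q.
  have := hy (fun y => exists b, D q (opt_env b (fun=> y))); apply.
    apply: gdef_ext Eq => x; rewrite (_ : x = fun=> x tt) //; by apply/funext => -[].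
  by move=> _ [a [b [ab ->]]]; exists a => -[P Pd] _ /=; rewrite mulVKg;
    split; [move/tp_eqP: ab|move/esym/tp_eqP: ab]; apply.
- exists b, (b * y); split; last by rewrite mulKg.
  apply/tp_eqP => P Pd.
  by have [] := bP [:: exist _ P Pd] (exist _ P Pd) (or_introl erefl).
Qed.

Definition closure_over (A : set G) : set G :=
  [set a | forall D, mdef D -> A `<=` D -> D a].

Lemma sub_closure_over A : A `<=` closure_over A.
Proof. by move=> a Aa D _; apply. Qed.

Lemma closed_closure_over A : closed_over (closure_over A).
Proof. by move=> a h D Dd AD; apply: h => // b; apply. Qed.

Local Notation F := (prod_set (closure_over Z) X).

(** For $a$ in the closure and $x\in Z$, compactness gives $x'$ of the type of $x$ with $ax'$ in the
    closure, because $Z=(Zx)x^{-1}$. Then $ax=(ax')(x'^{-1}x)$. *)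
Lemma closure_span_prod : prod_set (closure_over Z) Z = F.
Proof.
have [Z1 ZM ZV] := tp_span_subgroup.
apply/seteqP; split; last by apply: prod_setS => //; exact: sub_set_span.
move=> _ [a ha [x Zx <-]].
have [P Q [Pd Px] [Qd ZQ]|x' [x'x ax']] := saturated_above (A := [set x]) (B := Z) (y := a)
    (gvar None) (gfun_mul (gvar (Some tt)) (gvar None)).
  have [z Zz|q Qq [p Pp qpa]] := ha _ (mdef_prod Qd (mdef_inv Pd)).
    exists (z * x); first by apply: ZQ; exact: ZM.
    by exists x^-1; rewrite /= ?invgK ?mulgK //; exact: Px.
  by exists p^-1; split=> //=; rewrite -qpa mulgK.
have xx' : tp x = tp x'.
  by apply/tp_eqP => P Pd Px; apply: (x'x P); split=> // _ ->.
rewrite -(mulVKg x' x) mulgA; apply: mem_prod_set; last by exists x', x.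
by move=> Q Qd ZQ; exact: (ax' Q).
Qed.

Lemma closed_closure_span : closed_over F.
Proof. exact: closed_prod (@closed_closure_over _) closed_tp_ratio. Qed.

(** Normality of $Z$ makes $F$ stable under multiplication by $Z$ on both sides. For $a,b$ in the
    closure, $Z$ meets every definable set containing $a$, so some $a'$ of the type of $a$ has
    $a'b\in F$; then $ab$ is $a'b$ times a conjugate of the ratio $a'^{-1}a$. *)
Lemma closure_span_subgroup : is_subgroup F.
Proof.
have [Z1 ZM ZV] := tp_span_subgroup.
have cZV a : closure_over Z a -> closure_over Z a^-1.
  move=> ha D Dd ZD; apply: (ha _ (mdef_inv Dd)) => z Zz; apply: ZD; exact: ZV.
have FZ x z : F x -> Z z -> F (x * z).
  rewrite -closure_span_prod => -[a ha [y Zy <-]] Zz.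
  by rewrite -mulgA; apply: mem_prod_set => //; exact: ZM.
have ZF x z : F x -> Z z -> F (z * x).
  by move=> Fx Zz; rewrite -(mulVKg x (z * x)); apply: (FZ _ _ Fx);
    rewrite mulgA; exact: tp_span_normal.
have key a b : closure_over Z a -> closure_over Z b -> F (a * b).
  move=> ha hb.
  have [P Q [Pd Pa] [Qd FQ]|a' [a'a a'b]] := saturated_above (A := [set a]) (B := F) (y := b)
      (gvar None) (gfun_mul (gvar None) (gvar (Some tt))).
    have [z [Pz Zz]] : exists z, P z /\ Z z.
      apply: contrapT => n; apply: (ha (~` P) (mdefC Pd)) => //; last exact: Pa.
      by move=> z Zz Pz; apply: n; exists z.
    exists z; split=> //=; apply: FQ; apply: (ZF _ _ _ Zz).
    by rewrite -[b]mulg1; apply: mem_prod_set => //; exact: tp_ratio1.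
  have aa' : tp a = tp a'.
    by apply/tp_eqP => P Pd Pa; apply: (a'a P); split=> // _ ->.
  have Fa'b : F (a' * b).
    by apply: closed_closure_span => Q Qd FQ; exact: (a'b Q).
  rewrite -(mulVKg a' a) -mulgA (_ : a' * _ = (a' * b) * (b^-1 * (a'^-1 * a) * b)); last first.
    by rewrite !mulgA mulgK.
  apply: (FZ _ _ Fa'b); apply: tp_span_normal; apply: sub_set_span.
  by exists a', a.
split.
- by rewrite -[1]mulg1; apply: mem_prod_set; [exact: sub_closure_over|exact: tp_ratio1].
- move=> x y; rewrite -{1 2}closure_span_prod => -[a ha [z Zz <-]] [b hb [w Zw <-]].
  rewrite mulgA; apply: (FZ _ _ _ Zw).
  rewrite (_ : a * z * b = a * b * (b^-1 * z * b)); last by rewrite !mulgA mulgK.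
  by apply: (FZ _ _ (key _ _ ha hb)); exact: tp_span_normal.
- move=> x; rewrite -{1}closure_span_prod => -[a ha [z Zz <-]].
  rewrite invgM; apply: (ZF _ _ _ (ZV _ Zz)).
  by rewrite -[a^-1]mulg1; apply: mem_prod_set; [exact: cZV|exact: tp_ratio1].
Qed.

End Ratios.

(** * Ample sets *)

Section Ample.
Context (G : groupType).
Implicit Types (V W : set G) (R : G -> G -> Prop).

(** Below, [left_coset V x] serves as the translate $xV$ of an arbitrary set $V$. *)
Lemma left_cosetE V x y : left_coset V x y <-> V (x^-1 * y).
Proof.
split=> [[v Vv <-]|Vxy]; first by rewrite mulKg.
by exists (x^-1 * y) => //; rewrite mulVKg.
Qed.

Lemma left_cosetM V x y : left_coset (left_coset V y) x = left_coset V (x * y).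
Proof.
by apply/seteqP; split=> z /left_cosetE; rewrite ?invgM -?mulgA => h;
  apply/left_cosetE; [move/left_cosetE: h|apply/left_cosetE]; rewrite ?invgM -?mulgA.
Qed.

Lemma left_coset1 V : left_coset V 1 = V.
Proof.
by apply/seteqP; split=> z; rewrite left_cosetE invg1 mul1g.
Qed.

Lemma left_cosetS V W x : V `<=` W -> left_coset V x `<=` left_coset W x.
Proof. by move=> VW _ [v Vv <-]; exists v => //; exact: VW. Qed.

Lemma left_cosetI V W x :
  left_coset (V `&` W) x = left_coset V x `&` left_coset W x.
Proof.
apply/seteqP; split=> z; first by move=> /left_cosetE[? ?]; split; apply/left_cosetE.
by move=> [/left_cosetE ? /left_cosetE ?]; apply/left_cosetE.
Qed.

(* Unfolded one element at a time, so that its definability needs only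
   quantifiers over a single element of the group. *)
Fixpoint has_apart (A : set G) R n (acc : seq G) : Prop :=
  if n is n'.+1 then
    exists x, [/\ A x, forall y, y \in acc -> R x y & has_apart A R n' (x :: acc)]
  else True.

Lemma has_apartS A B R R' n acc :
  A `<=` B -> (forall x y, A x -> R x y -> R' x y) ->
  has_apart A R n acc -> has_apart B R' n acc.
Proof.
move=> AB RR'; elim: n acc => //= n IH acc [x [Ax xacc h]].
by exists x; split; [exact: AB|move=> y /xacc; exact: RR'|exact: IH].
Qed.

Lemma has_apart_mulr R n acc g :
  has_apart setT (fun x y => R (x * g) (y * g)) n acc ->
  has_apart setT R n (map ( *%g^~ g) acc).
Proof.
elim: n acc => //= n IH acc [x [_ xacc /IH h]].
by exists (x * g); split=> // _ /mapP[y yacc ->]; exact: xacc.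
Qed.

Lemma has_apart_extend A R n acc :
  (forall l : seq G, (forall y, y \in l -> A y) ->
    exists2 x, A x & forall y, y \in l -> R x y) ->
  (forall y, y \in acc -> A y) -> has_apart A R n acc.
Proof.
move=> ext; elim: n acc => //= n IH acc accA.
have [x Ax xacc] := ext acc accA; exists x; split=> //; apply: IH => y.
by rewrite inE => /orP[/eqP ->|/accA].
Qed.

(* A first-order surrogate for "V has measure at least t", where the list s
   depends on t: unlike the measure, it is definable uniformly in V. *)
Fixpoint ample (s : seq nat) V : Prop :=
  if s is n :: s' then
    ~ has_apart setT (fun x y => ~ ample s' (left_coset V x `&` left_coset V y)) n [::]
  else V !=set0.

(** Since $x(gV)=(xg)V$, apart translates of $gV$ are apart translates of $V$ with indices shifted
    on the right. *)
Lemma ample_left_coset s V g : ample s V -> ample s (left_coset V g).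
Proof.
case: s => [|n s] /=; first by move=> [v Vv]; exists (g * v), v.
apply: contra_not => h; apply: (has_apart_mulr (acc := [::]) (g := g)).
by apply: has_apartS h => // x y _; rewrite !left_cosetM.
Qed.

(** All translates of an empty set are apart, so a constant sequence refutes ampleness. *)
Lemma ample_neq0 s V : ample s V -> V !=set0.
Proof.
elim: s V => [//|n s IH] V /=; apply: contraPP => V0.
apply; apply: has_apart_extend => // l _; exists 1 => // y _ /IH[z [[v Vv _] _]].
by apply: V0; exists v.
Qed.

End Ample.

(** * Uniform definability of ample sets *)

Section AmpleDefinable.
Context (L : language) (M S : structure L) (j : M -> S) (G : definable_group S).
Local Notation gdef := (@gdef L M S j G).
Local Notation gfun := (@gfun L M S j G).
Local Notation gvar := (@gfun_var L M S j G _).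
Local Notation mdef := (@mdef L M S j G).

Definition gdef_rel (W : Type) (R : (W -> G) -> G -> G -> Prop) : Prop :=
  gdef (fun z : option (option W) -> G =>
    R (z \o Some \o Some) (z None) (z (Some None))).

Lemma gdef_forall_seq W W' (R : (W -> G) -> G -> G -> Prop) (r : W -> W')
    (x : W') (vs : seq W') : gdef_rel R ->
  gdef (fun z : W' -> G => forall y, y \in map z vs -> R (z \o r) (z x) y).
Proof.
move=> Rd; elim: vs => [|v vs IH]; first by apply: gdef_ext (gdefT j G _) => z.
have h := gdef_reindex (fun w => match w with
  | None => x | Some None => v | Some (Some w) => r w end) Rd.
apply: gdef_ext (gdefI h IH) => z; split=> [[h1 h2] y|hz].
  by rewrite inE => /orP[/eqP ->|/h2].
by split=> [|y yvs]; apply: hz; rewrite inE ?eqxx // yvs orbT.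
Qed.

(** Isolates one quantifier of [has_apart], to be bound in [gdef_has_apart] and to be witnessed in
    $G(M)$ in [ample_cons_model]. *)
Lemma gdef_has_apart_step W (R : (W -> G) -> G -> G -> Prop) n W' (r : W -> W')
    (vs : seq W') : gdef_rel R ->
  (forall W' (r : W -> W') vs,
    gdef (fun z : W' -> G => has_apart setT (R (z \o r)) n (map z vs))) ->
  gdef (fun z : option W' -> G =>
    (forall y, y \in map (z \o Some) vs -> R (z \o Some \o r) (z None) y) /\
    has_apart setT (R (z \o Some \o r)) n (z None :: map (z \o Some) vs)).
Proof.
move=> Rd IH.
apply: gdef_ext (gdefI (gdef_forall_seq (Some \o r) None (map Some vs) Rd)
  (IH _ (Some \o r) (None :: map Some vs))) => z /=.
by rewrite -map_comp.
Qed.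

Lemma gdef_has_apart W (R : (W -> G) -> G -> G -> Prop) n W' (r : W -> W')
    (vs : seq W') : gdef_rel R ->
  gdef (fun z : W' -> G => has_apart setT (R (z \o r)) n (map z vs)).
Proof.
move=> Rd; elim: n W' r vs => [|n IH] W' r vs; first exact: gdefT.
apply: gdef_ext (gdef_ex (gdef_has_apart_step r vs Rd IH)) => z /=.
by split=> [[x [h1 h2]]|[x [_ h1 h2]]]; exists x.
Qed.

(** The parameter type varies in the induction, because each level adds the two elements by which
    the set is translated. *)
Lemma gdef_ample s W (D : set (option W -> G)) : gdef D ->
  gdef (fun z : W -> G => ample s [set g | D (opt_env g z)]).
Proof.
elim: s W D => [|n s IH] W D Dd; first exact: gdef_ex.
pose R (z : W -> G) x y := ~ ample s
  (left_coset [set g | D (opt_env g z)] x `&` left_coset [set g | D (opt_env g z)] y).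
have Rd : gdef_rel R.
  have D1 := gdef_subst (fun w : W => Some (Some (Some w)))
    (gfun_mul (gfun_inv (gvar (Some None))) (gvar (None : option (option (option W))))) Dd.
  have D2 := gdef_subst (fun w : W => Some (Some (Some w)))
    (gfun_mul (gfun_inv (gvar (Some (Some None)))) (gvar (None : option (option (option W))))) Dd.
  apply: gdef_ext (gdefC (IH _ _ (gdefI D1 D2))) => z; rewrite /R /=.
  rewrite (_ : [set g | _ /\ _] = left_coset [set g | D (opt_env g (z \o Some \o Some))] (z None)
    `&` left_coset [set g | D (opt_env g (z \o Some \o Some))] (z (Some None))) //.
  by apply/seteqP; split=> g /=; rewrite !left_cosetE.
have := gdefC (gdef_has_apart n id [::] Rd).
by apply: gdef_ext => z.
Qed.

Lemma mdef_ample s (V : set G) : mdef V ->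
  mdef [set g | ample s (V `&` left_coset V g)].
Proof.
move=> Vd.
have h := gdefI (gdef_mem Vd (gvar (None : option unit)))
  (gdef_mem Vd (gfun_mul (gfun_inv (gvar (Some tt))) (gvar (None : option unit)))).
apply: gdef_ext (gdef_ample s h) => x /=.
rewrite (_ : [set g | _ /\ _] = V `&` left_coset V (x tt)) //.
by apply/seteqP; split=> g /=; rewrite left_cosetE.
Qed.

Context (K : Type) (hS : monster_model K j).

(** By elementarity an apart sequence can be rechosen in $G(M)$, one element at a time. This lets
    invariance under $G(M)$ alone prove ampleness. *)
Lemma ample_cons_model n s (V : set G) : mdef V ->
  ~ has_apart (group_points j G)
      (fun x y => ~ ample s (left_coset V x `&` left_coset V y)) n [::] ->
  ample (n :: s) V.
Proof.
move=> Vd /=; apply: contra_not.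
pose R (z : unit -> G) x y := ~ ample s (left_coset V x `&` left_coset V y).
have Rd : gdef_rel R.
  have D1 := gdef_mem Vd (gfun_mul (gfun_inv (gvar (Some None)))
    (gvar (None : option (option (option unit))))).
  have D2 := gdef_mem Vd (gfun_mul (gfun_inv (gvar (Some (Some None))))
    (gvar (None : option (option (option unit))))).
  apply: gdef_ext (gdefC (gdef_ample s (gdefI D1 D2))) => z; rewrite /R /=.
  rewrite (_ : [set g | _ /\ _] = left_coset V (z None) `&` left_coset V (z (Some None))) //.
  by apply/seteqP; split=> g /=; rewrite !left_cosetE.
have key m W (r : unit -> W) (vs : seq W) (z : W -> G) :
    (forall w, group_points j G (z w)) ->
    has_apart setT (R (z \o r)) m (map z vs) ->
    has_apart (group_points j G) (R (z \o r)) m (map z vs).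
  elim: m W r vs z => [//|m IH] W r vs z zM [x0 [_ h1 h2]].
  have [|b bM [k1 k2]] := gdef_witness hS zM (gdef_has_apart_step r vs Rd
    (fun W' r vs => gdef_has_apart m r vs Rd)); first by exists x0.
  exists b; split=> //.
  have := IH _ (Some \o r) (None :: map Some vs) (opt_env b z).
  by rewrite /= -map_comp; apply=> // -[].
by apply: (key n unit id [::] (fun=> 1)) => _; exact: (group_points1 G hS).
Qed.

End AmpleDefinable.

(** * Thick sets, coverings by translates, and compactness for products *)

Section Thick.
Context (L : language) (M S : structure L) (j : M -> S) (G : definable_group S).
Local Notation gdef := (@gdef L M S j G).
Local Notation gfun := (@gfun L M S j G).
Local Notation gvar := (@gfun_var L M S j G _).
Local Notation mdef := (@mdef L M S j G).
Local Notation closed_over := (@closed_over L M S j G).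
Local Notation tp := (@tp L M S j G).
Local Notation X := (@tp_ratio L M S j G).
Context (K : Type) (hS : monster_model K j).

Lemma group_pointsV g : group_points j G g -> group_points j G g^-1.
Proof.
move=> gM; have [|h hM /= hg] := mdef_witness hS (mdef_inv (mdef1 gM)).
  by exists g^-1; rewrite /= invgK.
by rewrite -hg invgK.
Qed.

Lemma group_pointsM g h :
  group_points j G g -> group_points j G h -> group_points j G (g * h).
Proof.
move=> gM hM.
have [|k kM /= <-] := mdef_witness hS (mdef_lmul (group_pointsV gM) (mdef1 hM)).
  by exists (g * h); rewrite /= mulKg.
by rewrite mulVKg.
Qed.

Lemma mdef_left_coset g V : group_points j G g -> mdef V -> mdef (left_coset V g).
Proof.
move=> gM Vd; apply: gdef_ext (mdef_lmul (group_pointsV gM) Vd) => x /=.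
by rewrite left_cosetE.
Qed.

Lemma closed_left_coset g V :
  group_points j G g -> closed_over V -> closed_over (left_coset V g).
Proof.
move=> gM Vc; rewrite (_ : left_coset V g = [set h | V (g^-1 * h)]).
  exact: closed_lmul (group_pointsV gM) Vc.
by apply/seteqP; split=> h; rewrite left_cosetE.
Qed.

(** Let $c$ realize over $a,b$ a coheir [U] of their common type. Then $a^{-1}c$ and $b^{-1}c$ lie
    in $Y$, since otherwise elements chosen successively along [U] would form an apart sequence of
    length $n$. *)
Lemma tp_ratio_sub_thick n (Y : set G) : mdef Y ->
  ~ has_apart setT (fun x y => ~ Y (x^-1 * y)) n [::] ->
  X `<=` [set g | exists y z, [/\ Y y, Y z & g = y * z^-1]].
Proof.
move=> Yd nap _ [a [b [ab ->]]].
have [U UU [UM Ua]] := ultrafilter_of_type hS a.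
have [c cr] := realize_filter hS (fun v : bool => if v then a else b)
  (not_embeds_bool hS) (@ultra_proper _ _ UU).
have key d : tp a = tp d -> realizes j U (fun _ : unit => d) c -> Y (d^-1 * c).
  move=> ad cd.
  have Dd : gdef (fun x : option unit -> G => Y ((x (Some tt))^-1 * x None)).
    exact: (gdef_mem Yd (gfun_mul (gfun_inv (gvar (Some tt))) (gvar None))).
  apply: (cd _ Dd) => /=.
  have [//|UnY] := in_ultra_setVsetC [set g | Y (d^-1 * g)] UU.
  exfalso; apply: nap.
  (* [N] consists of the $g$ from which [U]-almost all $m$ are apart, so any finite list in [N] can
     be extended inside [N]. *)
  pose N := [set g | U [set m | ~ Y (m^-1 * g)]].
  have UN : U N.
    apply: filterS (filterI UM UnY) => g [gM nY].
    have Ed : mdef [set m | ~ Y (m^-1 * g)].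
      apply: gdef_ext (gdefC (gdef_mem Yd
        (gfun_mul (gfun_inv (gvar tt)) (gfun_const unit gM)))) => x //.
    by apply: Ua => //; move/esym/tp_eqP: ad => /(_ _ Ed); apply.
  apply: (@has_apartS _ N setT (fun x y => ~ Y (x^-1 * y))) => //.
  apply: has_apart_extend => // l lN.
  have : U (N `&` [set m | forall y, y \in l -> ~ Y (m^-1 * y)]).
    apply: filterI => //; elim: l lN => [|y l IH] lN.
      by apply: filterS filterT => m _ y; rewrite in_nil.
    have Uy := lN y (mem_head _ _).
    have Ul : U [set m | forall y, y \in l -> ~ Y (m^-1 * y)].
      by apply: IH => z zl; apply: lN; rewrite inE zl orbT.
    apply: filterS (filterI Uy Ul) => m [h1 h2] z.
    by rewrite inE => /orP[/eqP ->|/h2].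
  by move=> /filter_ex[m [Nm hm]]; exists m.
have Ya := key a erefl (realizes1 (v := true) cr).
have Yb := key b ab (realizes1 (v := false) cr).
exists (a^-1 * c), (b^-1 * c); split=> //.
by rewrite invgM invgK mulgA mulgK.
Qed.

(** Otherwise some ultrafilter on $G(M)$ avoids every translate $mA$. Let $p$ realize it, and $q$
    realize it over $p$. As $q^{-1}p\in X\subseteq A$, finite satisfiability yields $m\in G(M)$ with
    $p\in mA$, which puts $mA$ into the ultrafilter. *)
Lemma tp_ratio_cover (A : set G) : mdef A -> X `<=` A ->
  exists2 l : seq G, (forall m, m \in l -> group_points j G m) &
    forall g, exists2 m, m \in l & left_coset A m g.
Proof.
move=> Ad XA; apply: contrapT => nc.
pose B (l : seq G) := group_points j G `&` [set g | forall m, m \in l -> ~ left_coset A m g].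
pose F := filter_from [set l : seq G | forall m, m \in l -> group_points j G m] B.
have FF : ProperFilter F.
  apply: filter_from_proper; last first.
    move=> l lM.
    have Dd : mdef [set g | forall m, m \in l -> ~ left_coset A m g].
      elim: l lM => [|m l IH] lM; first by apply: gdef_ext (gdefT j G _) => x.
      have lM' : forall m, m \in l -> group_points j G m.
        by move=> k kl; apply: lM; rewrite inE kl orbT.
      have h := mdefI (mdefC (mdef_left_coset (lM _ (mem_head _ _)) Ad)) (IH lM').
      apply: gdef_ext h => x /=; split=> [[h1 h2] k|h].
        by rewrite inE => /orP[/eqP ->|/h2].
      by split=> [|k kl]; apply: h; rewrite inE ?eqxx // kl orbT.
    have [|g gM hg] := mdef_witness hS Dd; last by exists g.
    apply: contrapT => n; apply: nc; exists l => // g.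
    apply: contrapT => ng; apply: n; exists g => m ml mg.
    by apply: ng; exists m.
  apply: filter_from_filter; first by exists [::] => m; rewrite in_nil.
  move=> l l' lM l'M; exists (l ++ l').
    by move=> m; rewrite mem_cat => /orP[/lM|/l'M].
  move=> g [gM h]; split; split=> // m ml; apply: h; rewrite mem_cat ml ?orbT //.
have [U [UU FU]] := ultraFilterLemma FF.
have UB l : (forall m, m \in l -> group_points j G m) -> U (B l).
  by move=> lM; apply: FU; exists l.
have UM : U (group_points j G).
  by apply: filterS (UB [::] _) => [g []|m] //; rewrite in_nil.
have UP := @ultra_proper _ _ UU.
have [p pr] := realize_filter hS (fun _ : unit => 1) (not_embeds_unit hS) UP.
have [q qr] := realize_filter hS (fun _ : unit => p) (not_embeds_unit hS) UP.
have Up D : mdef D -> D p -> U D.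
  move=> Dd Dp; have [//|UD] := in_ultra_setVsetC D UU.
  by have /(_ UD) := pr _ (gdef_reindex (fun=> None) (mdefC Dd)).
have pq : tp p = tp q := realizes_type Up qr.
have Aqp : A (q^-1 * p) by apply: XA; exists q, p.
have Dd : gdef (fun x : option unit -> G => ~ A ((x None)^-1 * x (Some tt))).
  exact: (gdefC (gdef_mem Ad (gfun_mul (gfun_inv (gvar None)) (gvar (Some tt))))).
have [UA|UA] := in_ultra_setVsetC [set m | A (m^-1 * p)] UU; last first.
  exact: (qr _ Dd UA).
have [m [mM /= Amp]] := filter_ex (filterI UM UA).
have U1 : U [set g | A (m^-1 * g)] by apply: Up => //; apply: mdef_lmul => //; exact: group_pointsV.
have mlM : forall k, k \in [:: m] -> group_points j G k by move=> k; rewrite inE => /eqP ->.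
have [g [Amg [_ ng]]] := filter_ex (filterI U1 (UB [:: m] mlM)).
by apply: (ng m); rewrite ?inE //; apply/left_cosetE.
Qed.

(** Compactness in two rounds, as saturation yields one element at a time: if every $AB$ left $D$,
    first some $a\in P$ and then some $b\in Q$ would have $ab\notin D$. *)
Lemma prod_set_sub_mdef (P Q D : set G) : closed_over P -> closed_over Q ->
  mdef D -> prod_set P Q `<=` D ->
  exists A B, [/\ mdef A, mdef B, P `<=` A, Q `<=` B & prod_set A B `<=` D].
Proof.
move=> Pc Qc Dd PQD; apply: contrapT => nAB.
have Dxy : gdef (fun x : option unit -> G => ~ D (x (Some tt) * x None)).
  exact: (gdefC (gdef_mem Dd (gfun_mul (gvar (Some tt)) (gvar None)))).
have bad A B : mdef_above j P A -> mdef_above j Q B ->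
    exists a, A a /\ exists b, B b /\ ~ D (a * b).
  move=> [Ad PA] [Bd QB]; apply: contrapT => h; apply: nAB.
  exists A, B; split=> // _ [a Aa [b Bb <-]].
  by apply: contrapT => nD; apply: h; exists a; split=> //; exists b.
have [a [aP aQ]] : exists a, (forall A, mdef_above j P A -> A a) /\
    forall B, mdef_above j Q B -> exists b, B b /\ ~ D (a * b).
  pose E B := [set a | exists b, B b /\ ~ D (a * b)].
  have Ed B : mdef B -> mdef (E B).
    move=> Bd; have h := gdef_ex (gdefI (gdef_mem Bd (gvar (None : option unit))) Dxy).
    by apply: gdef_ext h.
  pose I := ({A | mdef_above j P A} * {B | mdef_above j Q B})%type.
  pose mkI A (PA : mdef_above j P A) B (QB : mdef_above j Q B) : I :=
    (exist _ A PA, exist _ B QB).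
  pose F (i : I) (x : option unit -> G) := sval i.1 (x None) /\ E (sval i.2) (x None).
  have [|||[[A hA] [B hB]]|a aF] :=
      gdef_saturated hS (x := fun _ : unit => 1) (D := F) (not_embeds_unit hS).
  - by constructor; exact: mkI (mdef_aboveT j P) _ (mdef_aboveT j Q).
  - move=> [[A [Ad PA]] [B [Bd QB]]]; apply: gdefI; first exact: (gdef_mem Ad (gvar None)).
    exact: (gdef_mem (Ed _ Bd) (gvar None)).
  - move=> [[A hA] [B hB]] [[A' hA'] [B' hB']].
    exists (mkI _ (mdef_aboveI hA hA') _ (mdef_aboveI hB hB')).
    by move=> z [[? ?] [b [[? ?] ?]]]; split; split=> //; exists b.
  - exact: bad.
  - exists a; split=> [A hA|B hB].
      by have [] := aF (mkI _ hA _ (mdef_aboveT j Q)).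
    by have [] := aF (mkI _ (mdef_aboveT j P) _ hB).
pose F (i : {B | mdef_above j Q B}) (x : option unit -> G) :=
  sval i (x None) /\ ~ D (x (Some tt) * x None).
have [||[B hB] [B' hB']|[B hB]|b bF] :=
    gdef_saturated hS (x := fun _ : unit => a) (D := F) (not_embeds_unit hS).
- by constructor; exists setT; exact: mdef_aboveT.
- by move=> [B [Bd QB]]; apply: gdefI Dxy; exact: (gdef_mem Bd (gvar None)).
- by exists (exist _ _ (mdef_aboveI hB hB')) => z [[? ?] ?].
- exact: aQ.
have [_ nDab] := bF (exist _ setT (mdef_aboveT j Q)).
apply: nDab; apply: PQD; apply: mem_prod_set.
  by apply: Pc => A Ad PA; exact: aP.
by apply: Qc => B Bd QB; have [] := bF (exist _ B (conj Bd QB)).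
Qed.

End Thick.

(** * From the invariant measure on types of cosets to a set function *)

Section CosetMeasure.
Context (L : language) (M S : structure L) (j : M -> S)
  (G : definable_group S) (H : set G).
Local Notation closed_over := (@closed_over L M S j G).
Local Notation tp := (@tp L M S j G).

(** Such sets are unions of left cosets and also of right cosets of $H$, so one argument serves
    $G/H$ and $H\backslash G$. *)
Definition bi_closed (E : set G) : Prop :=
  closed_over E /\ forall h k x, H h -> H k -> E x -> E (h * x * k).

Context (c : G -> set G) (c_refl : forall a, c a a)
  (c_sub : forall a x, c a x -> exists h k, [/\ H h, H k & x = h * a * k]).

(** An automorphism over $M$ carries some element of $c(a)\subseteq HaH\subseteq E$ to $b$, and
    membership in $E$ depends only on the type over $M$. *)
Lemma coset_type_mem E a b : bi_closed E ->
  coset_type j c a = coset_type j c b -> E a -> E b.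
Proof.
move=> [Ec EH] ab Ea.
have ida : automorphism_over j (@id S).
  split; last by apply/funext.
  by split=> //; exists id.
have idc x : aut_image id (c x) = c x.
  apply/seteqP; split=> [g [k ck gk]|g cg]; last by exists g.
  by rewrite (coords_inj gk).
have : coset_orbit j c a (c b).
  move/(congr1 sval): ab => /= ->; exists id => //; exact: idc.
move=> [s sa sb].
have : aut_image s (c a) b by rewrite sb.
move=> [k /c_sub[h [h' [Hh Hh' kE]]] bk].
by apply: (closed_tp Ec (tp_aut sa bk)); rewrite kE; exact: EH.
Qed.

Definition coset_types (E : set G) : set (borel (coset_type_space j c)) :=
  [set coset_type j c a | a in E].

Lemma mem_coset_types E a : bi_closed E ->
  coset_types E (coset_type j c a) <-> E a.
Proof.
by move=> Ebi; split=> [[b Eb /(coset_type_mem Ebi)]|Ea]; [apply|exists a].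
Qed.

Lemma realizationE (p : type_space j G) : tp (realization p) = set_val p.
Proof. by rewrite /realization; case: cid2. Qed.

Lemma open_formula (phi : formula L ('I_(ambient_dim G) + M)) :
  open [set p : type_space j G | set_val p phi].
Proof.
exists [set [set p : type_space j G | set_val p phi]]; last by rewrite bigcup_set1.
move=> _ ->; exists (finmap.fset1 phi); first by move=> psi _; exact: in_setT.
apply/seteqP; split=> [p h|p pphi psi /=].
  by apply: (h phi); rewrite /= finmap.in_fset1.
by rewrite finmap.in_fset1 => /eqP ->.
Qed.

(** The image is closed: the preimage in $S_G(M)$ of its complement is the union of the open sets
    given by the negated formulas of $E$. *)
Lemma measurable_coset_types E : bi_closed E -> measurable (coset_types E).
Proof.
move=> Ebi; rewrite -[coset_types E]setCK; apply: measurableC.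
apply: sub_sigma_algebra.
rewrite /open /= /coset_type_open.
have [q Eq] := (closed_overP j E).1 Ebi.1.
rewrite (_ : _ @^-1` _ = \bigcup_(phi in q)
    [set p : type_space j G | set_val p (Not phi)]).
  by apply: bigcup_open => phi _; exact: open_formula.
apply/seteqP; split=> p.
  rewrite /coset_type_proj /= (mem_coset_types _ Ebi) {1}Eq /= => /existsNP[phi].
  move=> /not_implyP[qphi nphi]; exists phi => //=.
  by rewrite -realizationE.
move=> [phi qphi /=]; rewrite /coset_type_proj (mem_coset_types _ Ebi) {1}Eq /=.
by rewrite -realizationE => n /(_ _ qphi); exact: n.
Qed.

Lemma bi_closedI E F : bi_closed E -> bi_closed F -> bi_closed (E `&` F).
Proof.
move=> [Ec EH] [Fc FH]; split; first exact: closed_overI.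
by move=> h k x Hh Hk [Ex Fx]; split; [exact: EH|exact: FH].
Qed.

Lemma bi_closedU E F : bi_closed E -> bi_closed F -> bi_closed (E `|` F).
Proof.
move=> [Ec EH] [Fc FH]; split; first exact: closed_overU.
by move=> h k x Hh Hk [Ex|Fx]; [left; exact: EH|right; exact: FH].
Qed.

Lemma bi_closed0 : bi_closed set0.
Proof.
split=> // a /(_ set0); apply=> //.
by have := mdefC (mdefT j G); rewrite setCT.
Qed.

Context (K : Type) (hS : monster_model K j)
  (Hnorm : forall g, group_points j G g -> normalizes g H).

Lemma normalizes_conj g h : group_points j G g -> H h -> H (g^-1 * h * g).
Proof.
move=> gM Hh; have NH : [set g * h * g^-1 | h in H] = H := Hnorm gM.
move: Hh; rewrite -{1}NH => -[k Hk <-].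
by rewrite !mulgA mulVg mul1g mulgVK.
Qed.

(** Normalization of $H$ by $G(M)$ enters here, to move $H$ past $g$ on the left. *)
Lemma bi_closed_left_coset g E : group_points j G g -> bi_closed E ->
  bi_closed (left_coset E g).
Proof.
move=> gM [Ec EH]; split; first exact: (closed_left_coset hS gM Ec).
move=> h k x Hh Hk /left_cosetE Ex; apply/left_cosetE.
rewrite (_ : g^-1 * _ = (g^-1 * h * g) * (g^-1 * x) * k); last first.
  by rewrite !mulgA mulgK.
by apply: EH => //; exact: normalizes_conj.
Qed.

Lemma coset_types0 : coset_types set0 = set0.
Proof. exact: image_set0. Qed.

Lemma coset_typesT : coset_types setT = setT.
Proof.
apply/seteqP; split=> // -[p pP] _; have [a _ ap] := set_mem pP.
by exists a => //; exact: eq_exist.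
Qed.

Lemma coset_typesU E F : coset_types (E `|` F) = coset_types E `|` coset_types F.
Proof. exact: image_setU. Qed.

Lemma coset_typesI E F : bi_closed E -> bi_closed F ->
  coset_types (E `&` F) = coset_types E `&` coset_types F.
Proof.
move=> Eb Fb; apply/seteqP; split=> p; first by move=> [a [Ea Fa] <-]; split; exists a.
move=> [[a Ea <-]] /(mem_coset_types _ Fb) Fa; exists a => //.
Qed.

Lemma translate_coset_types g E : group_points j G g -> bi_closed E ->
  translate g (coset_types E) = coset_types (left_coset E g).
Proof.
move=> gM Eb; apply/seteqP; split=> p.
  by move=> [a /(mem_coset_types _ Eb) Ea <-]; exists (g * a) => //; exists a.
by move=> [_ [a Ea <-] <-]; exists a => //; exists a.
Qed.

End CosetMeasure.

(** The relevant sets form a lattice that is in general not closed under complement, hence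
    modularity instead of additivity. *)
Record bi_measure (R : realType) (L : language) (M S : structure L) (j : M -> S)
    (G : definable_group S) (H : set G) (nu : set G -> R) : Prop := BiMeasure {
  nu_set0 : nu set0 = 0%R;
  nu_setT : nu setT = 1%R;
  nu_le : forall E F, bi_closed j H E -> bi_closed j H F -> E `<=` F ->
    (nu E <= nu F)%R;
  nu_modular : forall E F, bi_closed j H E -> bi_closed j H F ->
    (nu (E `|` F) + nu (E `&` F) = nu E + nu F)%R;
  nu_left_coset : forall g E, group_points j G g -> bi_closed j H E ->
    nu (left_coset E g) = nu E }.

(** The value at $E$ is the measure of the set of types of cosets $c(a)$ with $a\in E$. On bi-closed
    sets this image commutes with intersections as well as unions. *)
Lemma bi_measure_of_cosets (R : realType) (L : language) (M S : structure L)
    (j : M -> S) (G : definable_group S) (H : set G) (K : Type) (c : G -> set G) :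
  monster_model K j -> (forall g, group_points j G g -> normalizes g H) ->
  (forall a, c a a) ->
  (forall a x, c a x -> exists h k, [/\ H h, H k & x = h * a * k]) ->
  carries_invariant_probability R j c ->
  exists nu : set G -> R, bi_measure j H nu.
Proof.
move=> hS Hnorm c_refl c_sub [mu mu_inv].
pose ct := @coset_types L M S j G c.
have mE E : bi_closed j H E -> measurable (ct E).
  move=> Eb; exact (@measurable_coset_types L M S j G H c c_refl c_sub E Eb).
have fE E : bi_closed j H E -> mu (ct E) \is a fin_num.
  by move=> Eb; apply: fin_num_measure; exact: mE.
exists (fun E => fine (mu (ct E))); split.
- by rewrite /ct coset_types0 measure0.
- by rewrite /ct coset_typesT probability_setT.
- move=> E F Eb Fb EF; apply: fine_le; [exact: fE|exact: fE|].
  by apply: le_measure; rewrite ?inE; [exact: mE|exact: mE|exact: image_subset].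
- move=> E F Eb Fb; have Ib := bi_closedI Eb Fb.
  have mI := mE _ Ib; rewrite /ct (coset_typesI c_refl c_sub Eb Fb) in mI.
  rewrite /ct coset_typesU (coset_typesI c_refl c_sub Eb Fb) measureUfinr //; last first.
  + by rewrite ltey_eq fE.
  + exact: mE.
  + exact: mE.
  rewrite fineB ?fineD ?fin_numD ?fE //; first by rewrite subrK.
  by rewrite -(coset_typesI c_refl c_sub Eb Fb) fE.
- move=> g E gM Eb; rewrite /ct -(translate_coset_types c_refl c_sub gM Eb).
  by rewrite mu_inv //; exact: mE.
Qed.

(** * The Massicot-Wagner argument *)

Section Core.
Context (R : realType) (L : language) (M S : structure L) (j : M -> S)
  (G : definable_group S) (K : Type) (hS : monster_model K j)
  (H : set G) (hH : is_subgroup H).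
Local Notation gdef := (@gdef L M S j G).
Local Notation gvar := (@gfun_var L M S j G _).
Local Notation mdef := (@mdef L M S j G).
Local Notation closed_over := (@closed_over L M S j G).
Local Notation GM := (group_points j G).
Local Notation X := (@tp_ratio L M S j G).
Local Notation Z := (set_span X).
Local Notation bi_closed := (@bi_closed L M S j G H).
Context (Hclosed : closed_over H)
  (Hnorm : forall g, GM g -> normalizes g H).

Definition hull (E : set G) : set G := prod_set H (prod_set E H).

Lemma hullP E x :
  hull E x <-> exists h e k, [/\ H h, E e, H k & x = h * e * k].
Proof.
split=> [[h Hh [_ [e Ee [k Hk <-]] <-]]|[h [e [k [Hh Ee Hk ->]]]]].
  by exists h, e, k; rewrite mulgA.
by rewrite -mulgA; apply: mem_prod_set => //; exact: mem_prod_set.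
Qed.

Lemma sub_hull E : E `<=` hull E.
Proof.
have [H1 _ _] := hH => e Ee; apply/hullP; exists 1, e, 1.
by rewrite mul1g mulg1.
Qed.

Lemma hullS E F : E `<=` F -> hull E `<=` hull F.
Proof. by move=> EF; apply: prod_setS => //; exact: prod_setS. Qed.

Lemma bi_closed_hull E : closed_over E -> bi_closed (hull E).
Proof.
have [_ HM _] := hH.
move=> Ec; split; first by apply: (closed_prod hS) => //; exact: (closed_prod hS).
move=> h k x Hh Hk /hullP[h' [e [k' [Hh' Ee Hk' ->]]]].
apply/hullP; exists (h * h'), e, (k' * k); rewrite !mulgA.
by split=> //; exact: HM.
Qed.

Lemma left_coset_hull g E : GM g -> left_coset (hull E) g = hull (left_coset E g).
Proof.
move=> gM; apply/seteqP; split=> [_ [_ /hullP[h [e [k [Hh Ee Hk ->]]]] <-]|].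
  apply/hullP; exists (g * h * g^-1), (g * e), k; split=> //.
  - have := normalizes_conj Hnorm (group_pointsV hS gM) Hh.
    by rewrite invgK.
  - by exists e.
  - by rewrite !mulgA mulgVK.
move=> _ /hullP[h [_ [k [Hh [e Ee <-] Hk ->]]]].
apply/left_cosetE/hullP; exists (g^-1 * h * g), e, k; split=> //.
  exact (normalizes_conj Hnorm gM Hh).
by rewrite !mulgA.
Qed.

Context (nu : set G -> R) (nuP : bi_measure j H nu).

Lemma nu_ge0 E : bi_closed E -> (0 <= nu E)%R.
Proof.
move=> Eb; rewrite -(nu_set0 nuP); apply: (nu_le nuP) => //.
exact: (bi_closed0 j H).
Qed.

Lemma nu_le1 E : bi_closed E -> (nu E <= 1)%R.
Proof.
by move=> Eb; rewrite -(nu_setT nuP); apply: (nu_le nuP).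
Qed.

Lemma nu_hull_left_coset g E : GM g -> closed_over E ->
  nu (hull (left_coset E g)) = nu (hull E).
Proof.
move=> gM Ec; rewrite -left_coset_hull // (nu_left_coset nuP) //.
exact: bi_closed_hull.
Qed.

Definition translates (E : set G) (l : seq G) : set G :=
  [set x | exists2 m, m \in l & left_coset E m x].

Lemma translates_cons E m l :
  translates E (m :: l) = left_coset E m `|` translates E l.
Proof.
apply/seteqP; split=> x; last first.
  move=> [mx|[k kl kx]]; first by exists m; rewrite ?mem_head.
  by exists k => //; rewrite inE kl orbT.
by move=> [k]; rewrite inE => /orP[/eqP ->|kl kx]; [left|right; exists k].
Qed.

Lemma bi_closed_translates E l : bi_closed E -> (forall m, m \in l -> GM m) ->
  bi_closed (translates E l).
Proof.
move=> Eb; elim: l => [|m l IH] lM.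
  rewrite (_ : translates E [::] = set0); first exact: bi_closed0.
  by apply/seteqP; split=> x // -[m]; rewrite in_nil.
rewrite translates_cons; apply: bi_closedU.
  by apply: (bi_closed_left_coset hS Hnorm) => //; apply: lM; rewrite mem_head.
by apply: IH => k kl; apply: lM; rewrite inE kl orbT.
Qed.

Lemma nu_setI_translates E x l (t : R) : bi_closed E -> GM x ->
  (forall m, m \in l -> GM m) ->
  (forall m, m \in l -> nu (left_coset E x `&` left_coset E m) <= t)%R ->
  (nu (left_coset E x `&` translates E l) <= (size l)%:R * t)%R.
Proof.
move=> Eb xM; elim: l => [|m l IH] lM lt.
  rewrite (_ : _ `&` _ = set0) ?(nu_set0 nuP) ?mul0r //.
  by apply/seteqP; split=> y // -[_ [m]]; rewrite in_nil.
have lM' : forall k, k \in l -> GM k by move=> k kl; apply: lM; rewrite inE kl orbT.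
have lt' : forall k, k \in l -> (nu (left_coset E x `&` left_coset E k) <= t)%R.
  by move=> k kl; apply: lt; rewrite inE kl orbT.
have xb : bi_closed (left_coset E x) by exact: (bi_closed_left_coset hS Hnorm).
have mb : bi_closed (left_coset E m).
  by apply: (bi_closed_left_coset hS Hnorm) => //; apply: lM; rewrite mem_head.
have lb := bi_closed_translates Eb lM'.
have := nu_modular nuP (bi_closedI xb mb) (bi_closedI xb lb).
rewrite translates_cons setIUr.
have := nu_ge0 (bi_closedI (bi_closedI xb mb) (bi_closedI xb lb)).
have := IH lM' lt'; have := lt m (mem_head _ _).
rewrite /= -natr1 mulrDl mul1r; lra.
Qed.

(** Finitely many translates of $A$ by $G(M)$ cover $G$, so the total mass 1 is at most a multiple
    of the measure of $HAH$. *)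
Lemma nu_hull_gt0 A : mdef A -> X `<=` A -> (0 < nu (hull A))%R.
Proof.
move=> Ad XA; have [l lM lcov] := tp_ratio_cover hS Ad XA.
have Ab : bi_closed (hull A) by apply: bi_closed_hull; exact: mdef_closed.
have sub : forall l : seq G, (forall m, m \in l -> GM m) ->
    (nu (translates (hull A) l) <= (size l)%:R * nu (hull A))%R.
  elim=> [|m k IH] kM.
    rewrite (_ : translates _ _ = set0) ?(nu_set0 nuP) ?mul0r //.
    by apply/seteqP; split=> y // -[m]; rewrite in_nil.
  have mM : GM m by apply: kM; rewrite mem_head.
  have kM' : forall x, x \in k -> GM x by move=> x xk; apply: kM; rewrite inE xk orbT.
  have mb := bi_closed_left_coset hS Hnorm mM Ab.
  have kb := bi_closed_translates Ab kM'.
  have := nu_modular nuP mb kb; rewrite translates_cons.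
  rewrite (nu_left_coset nuP mM Ab).
  have := nu_ge0 (bi_closedI mb kb); have := IH kM'.
  rewrite /= -natr1 mulrDl mul1r; lra.
have := sub l lM; rewrite (_ : translates _ _ = setT); last first.
  apply/seteqP; split=> // x _; have [m ml mx] := lcov x; exists m => //.
  by apply: left_cosetS mx; exact: sub_hull.
rewrite (nu_setT nuP) lt_neqAle nu_ge0 // andbT => h; apply/eqP => h0.
by move: h; rewrite -h0 mulr0 ler10.
Qed.

(** Many translates of measure at least $t$ with small pairwise intersections would exceed the total
    mass. The measure is taken of a bi-closed $E$ inside $V$, because $V$ itself is only
    definable. *)
Lemma ample_of_measure d (t : R) : (0 < t)%R -> exists2 s, size s = d &
  forall E V, bi_closed E -> (t <= nu E)%R -> mdef V -> E `<=` V -> ample s V.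
Proof.
elim: d t => [|d IH] t t0.
  exists [::] => // E V Eb tE Vd EV /=; apply: contrapT => V0.
  move: tE; rewrite (_ : E = set0) ?(nu_set0 nuP); first by rewrite leNgt t0.
  by apply/seteqP; split=> // x Ex; apply: V0; exists x; exact: EV.
(* As $nt>2$ and $n^2t'=1/2$, a union of $n$ translates overlapping pairwise in at most $t'$ would
   have measure at least $nt-n^2t'>1$. *)
pose n := (Num.truncn (2 / t)%R).+1.
have nt : (2 < n%:R * t)%R.
  by rewrite -ltr_pdivrMr //; exact: Num.Theory.truncnS_gt.
have n0 : (0 < n%:R :> R)%R by rewrite ltr0n.
pose t' := (1 / (2 * n%:R ^+ 2) : R)%R.
have t'0 : (0 < t')%R by rewrite divr_gt0 // mulr_gt0 // exprn_gt0.
have nt' : (n%:R ^+ 2 * t' = 1 / 2)%R.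
  by rewrite /t' !mul1r invfM mulrCA divff ?mulr1 // expf_neq0 // lt0r_neq0.
have [s ssize sP] := IH _ t'0.
exists (n :: s); first by rewrite /= ssize.
move=> E V Eb tE Vd EV; apply: (ample_cons_model hS) => // hap.
(* The $k$ translates collected fill at least $kt-k^2t'$. The next one overlaps them in at most
   $kt'$, which is within the increment $(2k+1)t'$. *)
have claim m acc : (forall y, y \in acc -> GM y) ->
    ((size acc)%:R * t - (size acc)%:R ^+ 2 * t' <= nu (translates E acc))%R ->
    has_apart GM (fun x y => ~ ample s (left_coset V x `&` left_coset V y)) m acc ->
    ((size acc + m)%:R * t - (size acc + m)%:R ^+ 2 * t' <= 1)%R.
  elim: m acc => [|m IHm] acc accM acct.
    by move=> _; rewrite addn0; apply: (le_trans acct); apply/nu_le1/bi_closed_translates.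
  move=> /= [x [xM xacc hm]].
  have accM' y : y \in x :: acc -> GM y by rewrite inE => /orP[/eqP ->|/accM].
  rewrite addnS -addSn; apply: (IHm (x :: acc)) => //.
  have xb := bi_closed_left_coset hS Hnorm xM Eb.
  have ab := bi_closed_translates Eb accM.
  have := nu_modular nuP xb ab; rewrite translates_cons (nu_left_coset nuP xM Eb).
  have : (nu (left_coset E x `&` translates E acc) <= (size acc)%:R * t')%R.
    apply: nu_setI_translates => // y yacc; rewrite leNgt; apply/negP => /ltW yt.
    have yM := accM _ yacc.
    apply: (xacc _ yacc); apply: (sP (left_coset E x `&` left_coset E y)) => //.
    - by apply: bi_closedI => //; exact: (bi_closed_left_coset hS Hnorm).
    - by apply: mdefI; exact: (mdef_left_coset hS).
    - by apply: setISS; exact: left_cosetS.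
  rewrite /= -natr1; set k := (size acc)%:R%R in acct *.
  have k0 : (0 <= k)%R by exact: ler0n.
  have kt' : (0 <= k * t')%R by rewrite mulr_ge0 // ltW.
  have -> : ((k + 1) ^+ 2 * t' = k ^+ 2 * t' + 2 * (k * t') + t')%R.
    by lra.
  rewrite mulrDl mul1r; lra.
have := claim n [::] _ _ hap; rewrite /= add0n nt' mul0r expr0n /= mul0r subrr.
have e0 : (0 <= nu (translates E [::]))%R by apply/nu_ge0/bi_closed_translates.
move=> /(_ _ e0) h; have {h} := h (fun y => False_rect _ \o notF); lra.
Qed.

Lemma closed_hull_prod V A : mdef V -> mdef A -> bi_closed (hull (prod_set V A)).
Proof. by move=> Vd Ad; exact: (bi_closed_hull (mdef_closed (mdef_prod Vd Ad))). Qed.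

(* If no V is nearly minimal, nu (hull (prod_set V A)) drops by a factor 1 + e at
   each of the [size s] levels. *)
Lemma ample_descent (e : R) A C : (0 < e)%R -> mdef A -> forall s V,
  mdef V -> V `<=` C -> ample s V ->
  (exists n s' V', [/\ mdef V', V' `<=` C, ample (n :: s') V' &
     forall W, mdef W -> W `<=` C -> ample s' W ->
       (nu (hull (prod_set V' A)) < (1 + e) * nu (hull (prod_set W A)))%R]) \/
  ((1 + e) ^+ size s * nu (hull A) <= nu (hull (prod_set V A)))%R.
Proof.
move=> e0 Ad; elim=> [|n s IH] V Vd VC Vs.
  right; rewrite expr0 mul1r.
  (* For $v\in V\cap G(M)$, the hull of $vA\subseteq VA$ has the same measure as that of $A$. *)
  have [v vM Vv] := mdef_witness hS Vd Vs.
  rewrite -(nu_hull_left_coset vM (mdef_closed Ad)); apply: (nu_le nuP).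
  - exact: (bi_closed_hull (mdef_closed (mdef_left_coset hS vM Ad))).
  - exact: closed_hull_prod.
  - by apply: hullS => _ [a Aa <-]; exact: mem_prod_set.
have [[W [Wd WC Ws WV]]|good] := pselect (exists W, [/\ mdef W, W `<=` C, ample s W &
    ((1 + e) * nu (hull (prod_set W A)) <= nu (hull (prod_set V A)))%R]).
  have [|WA] := IH W Wd WC Ws; [by left|right].
  apply: le_trans WV; rewrite /= exprS -mulrA ler_pM2l //; lra.
left; exists n, s, V; split=> // W Wd WC Ws; rewrite ltNge; apply/negP => WV.
by apply: good; exists W.
Qed.

(** Induction through the definable set of $g$ with $Yg\subseteq D$: for $p\in G(M)$, any $y\in Y$
    with $yp\notin D$ could be replaced by one in $G(M)$. *)
Lemma set_pow_model Y k D : mdef Y -> mdef D ->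
  set_pow (Y `&` GM) k `<=` D -> set_pow Y k `<=` D.
Proof.
move=> Yd; elim: k D => [//|k IH] D Dd YD.
pose D' := [set g | forall y, Y y -> D (y * g)].
have D'd : mdef D'.
  have := gdef_ex (gdefI (gdef_mem Yd (gvar None))
    (gdefC (gdef_mem Dd (gfun_mul (gvar None) (gvar (Some tt)))))).
  move=> /gdefC; apply: gdef_ext => x; split=> [h y Yy|h [y [Yy nD]]].
    by apply: contrapT => nD; apply: h; exists y.
  by apply: nD; exact: h.
have powM p : set_pow (Y `&` GM) k p -> GM p.
  elim: k p {IH YD} => [|k IHk] p /=; first by move=> ->; exact: (group_points1 G hS).
  by move=> [a [_ aM] [b /IHk bM <-]]; exact: (group_pointsM hS).
have YD' : set_pow (Y `&` GM) k `<=` D'.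
  move=> p pk y0 Yy0; apply: contrapT => nD.
  have Ed : mdef [set y | Y y /\ ~ D (y * p)].
    by apply: mdefI => //; apply: mdefC; apply: mdef_rmul => //; exact: powM.
  have [|y yM [Yy nDy]] := mdef_witness hS Ed; first by exists y0.
  by apply: nDy; apply: YD; apply: mem_prod_set.
by move=> _ [y Yy [p pk <-]]; exact: (IH _ D'd YD' p pk).
Qed.

Lemma ample_setI_left_coset s (V : set G) (x y : G) :
  ample s (left_coset V x `&` left_coset V y) ->
  ample s (V `&` left_coset V (x^-1 * y)).
Proof.
move=> /(ample_left_coset x^-1).
by rewrite left_cosetI !left_cosetM mulVg left_coset1.
Qed.

(** Each factor costs at most $d$: $B\cap gB$ and $g(B\cap pB)$ both lie in $gB$, of measure $q$,
    and their intersection lies in $B\cap gpB$. *)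
Lemma nu_setI_set_pow (B Y : set G) (q d : R) k : bi_closed B -> (nu B = q)%R ->
  (forall g, Y g -> GM g -> (q - d <= nu (B `&` left_coset B g))%R) ->
  forall y, set_pow (Y `&` GM) k y ->
    GM y /\ (q - k%:R * d <= nu (B `&` left_coset B y))%R.
Proof.
move=> Bb Bq Yq; elim: k => [|k IH] y /=.
  move=> ->; split; first exact: (group_points1 G hS).
  by rewrite left_coset1 setIid mul0r subr0 Bq.
move=> [g [Yg gM] [p /IH[pM pB] <-]]; split; first exact: (group_pointsM hS).
have gb := bi_closed_left_coset hS Hnorm gM Bb.
have pb := bi_closed_left_coset hS Hnorm pM Bb.
have gpb := bi_closed_left_coset hS Hnorm gM (bi_closedI Bb pb).
have gpb' := bi_closed_left_coset hS Hnorm (group_pointsM hS gM pM) Bb.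
have := nu_modular nuP (bi_closedI Bb gb) gpb.
rewrite (nu_left_coset nuP gM (bi_closedI Bb pb)).
have : (nu ((B `&` left_coset B g) `|` left_coset (B `&` left_coset B p) g) <= q)%R.
  rewrite -Bq -(nu_left_coset nuP gM Bb); apply: (nu_le nuP) => //.
    by apply: bi_closedU => //; exact: bi_closedI.
  by move=> x [[_ //]|]; rewrite left_cosetI => -[].
have : (nu (B `&` left_coset B g `&` left_coset (B `&` left_coset B p) g) <=
    nu (B `&` left_coset B (g * p)))%R.
  apply: (nu_le nuP); [by apply: bi_closedI => //; exact: bi_closedI|exact: bi_closedI|].
  by move=> x [[Bx _]]; rewrite left_cosetI left_cosetM => -[_ ?].
have := Yq g Yg gM; rewrite -natr1 mulrDl mul1r; lra.
Qed.

(** The exponent 8 is uniform in $k$, although the auxiliary $V$ and $Y$ depend on $k$. *)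
Lemma tp_ratio_pow_sub (C : set G) k : mdef C -> (forall x, C x -> C x^-1) ->
  hull X `<=` C -> set_pow X k `<=` set_pow C 8.
Proof.
move=> Cd CV XC.
have [H1 HM HV] := hH.
have HC : H `<=` C.
  move=> h Hh; apply: XC; apply/hullP; exists h, 1, 1.
  by rewrite !mulg1; split=> //; exact: tp_ratio1.
have Xc := closed_tp_ratio (G := G) hS.
(* Compactness, applied twice to $H(XH)\subseteq C$, gives a definable $A\supseteq X$ with
   $HAH\subseteq C$. *)
have [A1 [B1 [_ B1d HA1 XB1 AB1]]] := prod_set_sub_mdef hS Hclosed
  (closed_prod hS Xc Hclosed) Cd XC.
have [A [B2 [Ad _ XA HB2 AB2]]] := prod_set_sub_mdef hS Xc Hclosed B1d XB1.
have AC : hull A `<=` C.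
  apply: subset_trans AB1; apply: prod_setS => //.
  by apply: subset_trans AB2; exact: prod_setS.
have t0 := nu_hull_gt0 Ad XA.
have Ab : bi_closed (hull A) := bi_closed_hull (mdef_closed Ad).
(* With $e=1/(2k+1)$, losing $eq$ for each of $2k$ factors still leaves $eq>0$. *)
pose e : R := (1 / (k + k).+1%:R)%R.
have e0 : (0 < e)%R by rewrite divr_gt0 ?ltr0n.
(* This many levels rule out the growth alternative of [ample_descent], since measures are at most
   1. *)
have [d dlt] : exists d : nat, (1 < (1 + e) ^+ d * nu (hull A))%R.
  pose d := (Num.truncn (1 / (e * nu (hull A)))%R).+1; exists d.
  have : (1 < d%:R * (e * nu (hull A)))%R.
    by rewrite -ltr_pdivrMr ?mulr_gt0 //; exact: Num.Theory.truncnS_gt.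
  have bernoulli m : (1 + m%:R * e <= (1 + e) ^+ m)%R.
    elim: m => [|m IHm]; first by rewrite mul0r addr0 expr0.
    rewrite exprS -natr1; have := ler_wpM2l (ltW e0) IHm.
    have : (0 <= e * (m%:R * e))%R by rewrite !mulr_ge0 // ltW.
    lra.
  move: (bernoulli d) => h1 h2; have := ler_wpM2r (ltW t0) h1; lra.
have [s ssize sP] := ample_of_measure d t0.
have Cs : ample s C by apply: (sP (hull A)).
have [good|] := ample_descent e0 Ad Cd (@subset_refl _ C) Cs; last first.
  rewrite ssize => h; have := nu_le1 (closed_hull_prod Cd Ad); lra.
have [n [s' [V [Vd VC Vs Vmin]]]] := good.
pose B := hull (prod_set V A); pose q := nu B.
have Bb : bi_closed B by exact: closed_hull_prod.
pose Y := [set g | ample s' (V `&` left_coset V g)].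
have Yd : mdef Y by exact: mdef_ample.
have q0 : (0 < q)%R.
  have [v vM Vv] := mdef_witness hS Vd (ample_neq0 Vs).
  apply: lt_le_trans t0 _; rewrite -(nu_hull_left_coset vM (mdef_closed Ad)).
  apply: (nu_le nuP) => //.
    exact: (bi_closed_hull (mdef_closed (mdef_left_coset hS vM Ad))).
  by apply: hullS => _ [a Aa <-]; exact: mem_prod_set.
(* $W=V\cap gV$ is ample one level down, so near-minimality of $V$ bounds from below the measure of
   $HWAH$, which is contained in $B\cap gB$. *)
have Yq g : Y g -> GM g -> (q - e * q <= nu (B `&` left_coset B g))%R.
  move=> Yg gM; set W := V `&` left_coset V g.
  have Wd : mdef W by apply: mdefI => //; exact: (mdef_left_coset hS).
  have := Vmin W Wd (subset_trans (@subIsetl _ _ _) VC) Yg; rewrite -/B -/q.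
  have WB : (nu (hull (prod_set W A)) <= nu (B `&` left_coset B g))%R.
    apply: (nu_le nuP); first exact: closed_hull_prod.
      by apply: bi_closedI => //; exact: (bi_closed_left_coset hS Hnorm).
    move=> x Wx; split.
      by apply: hullS Wx; apply: prod_setS => // ? [].
    rewrite left_coset_hull //; apply: hullS Wx.
    move=> _ [w [_ /left_cosetE Vw] [a Aa <-]]; apply/left_cosetE.
    by rewrite mulgA; exact: mem_prod_set.
  set w := nu (hull (prod_set W A)) in WB * => qw.
  have : (q - e * q <= w)%R.
    have [qw'|/ltW wq] := leP q w.
      have : (0 <= e * q)%R by rewrite mulr_ge0 // ltW.
      lra.
    have := ler_wpM2l (ltW e0) wq; lra.
  by move=> h; apply: le_trans h WB.
pose BB := prod_set B [set g | B g^-1].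
have BBc : closed_over BB.
  by apply: (closed_prod hS) => //; [exact: Bb.1|exact: closed_inv Bb.1].
(* Positive measure makes $B\cap yB$ nonempty, so $y\in BB^{-1}$. *)
have YBB : set_pow (Y `&` GM) (k + k) `<=` BB.
  move=> y yk; have [yM] := nu_setI_set_pow (q := q) (k := (k + k)%N) Bb erefl Yq yk.
  have : (0 < q - (k + k)%:R * (e * q))%R.
    have : ((k + k)%:R * e + e = 1)%R.
      by rewrite -[X in (_ + X)%R]mul1r -mulrDl natr1 mulrCA divff ?mulr1.
    move=> /(congr1 (fun x => x * q)%R); rewrite mulrDl mul1r -mulrA.
    have : (0 < e * q)%R by rewrite mulr_gt0.
    lra.
  move=> h1 h2; have : B `&` left_coset B y !=set0.
    apply/set0P/eqP => B0; move: h2; rewrite B0 (nu_set0 nuP); lra.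
  move=> [x [Bx /left_cosetE By]].
  have -> : y = x * (y^-1 * x)^-1 by rewrite invgM invgK mulgA mulgV mul1g.
  by apply: mem_prod_set => //=; rewrite invgK.
(* [BB] is type-definable over $M$, so the inclusion passes from $G(M)$ to $G$ through its definable
   supersets. *)
have YBB' : set_pow Y (k + k) `<=` BB.
  move=> y yk; apply: BBc => D Dd BBD.
  by apply: (set_pow_model Yd Dd _ yk); apply: subset_trans YBB BBD.
have YV g : Y g -> Y g^-1.
  rewrite /Y /= => /(ample_left_coset g^-1).
  by rewrite left_cosetI left_cosetM mulVg left_coset1 setIC.
(* Ampleness of $V$ at the upper level makes $Y$ thick. *)
have XYY : X `<=` prod_set Y Y.
  have nap : ~ has_apart setT (fun x y => ~ Y (x^-1 * y)) n [::].
    apply: contra_not Vs; apply: has_apartS => // x y _; apply: contra_not.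
    exact: ample_setI_left_coset.
  move=> g /(tp_ratio_sub_thick hS Yd nap)[y [z [Yy Yz ->]]].
  by apply: mem_prod_set => //; exact: YV.
have XY l : set_pow X l `<=` set_pow Y (l + l).
  elim: l => [//|l IHl] _ [_ /XYY[y Yy [z Yz <-]] [p /IHl Yp <-]].
  rewrite addSn addnS -mulgA; apply: mem_prod_set => //.
  exact: mem_prod_set.
(* $B=HVAH$ is a product of four subsets of $C$, whence $BB^{-1}\subseteq C^8$. *)
have BC : B `<=` set_pow C 4.
  move=> _ /hullP[h [_ [h' [Hh [v Vv [a Aa <-]] Hh' ->]]]].
  rewrite -!mulgA; apply: mem_prod_set; first exact: HC.
  apply: mem_prod_set; first exact: VC.
  apply: mem_prod_set; first by apply: AC; exact: sub_hull.
  by apply: set_pow1; exact: HC.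
move=> _ /XY/YBB'[b Bb' [b' Bb'' <-]].
apply: (set_powM (k := 4) (l := 4)); first exact: BC.
by rewrite -[b']invgK; apply: set_powV => //; exact: BC.
Qed.

End Core.

(** * Closures and bounded index *)

Section Coding.
Context (L : language).

Lemma term_map_can (V W : Type) (f : V -> W) (g : W -> V) : cancel f g ->
  cancel (@term_map L V W f) (term_map g).
Proof.
move=> fK; elim=> [v|h args IH] /=; first by rewrite fK.
by congr App; apply/funext => i.
Qed.

Lemma rename_can (V W : Type) (f : V -> W) (g : W -> V) : cancel f g ->
  cancel (@rename L V W f) (rename g).
Proof.
move=> fK phi; elim: phi W f g fK => {V} //=.
- by move=> V t u W f g fK; rewrite !(term_map_can fK).
- by move=> V r args W f g fK; congr Rel; apply/funext => i; rewrite (term_map_can fK).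
- by move=> V phi IH1 psi IH2 W f g fK; rewrite (IH1 _ _ _ fK) (IH2 _ _ _ fK).
- move=> V phi IH W f g fK; congr All; apply: IH => -[v|] //=.
  by rewrite fK.
Qed.

Fixpoint Alls n (V : Type) : formula L (V + 'I_n) -> formula L V :=
  match n return formula L (V + 'I_n) -> formula L V with
  | 0 => rename (@drop_block0 V)
  | n'.+1 => fun phi => All (Alls (rename (@block_assoc n' V) phi))
  end.

Lemma Alls_inj n V : injective (@Alls n V).
Proof.
elim: n V => [|n IH] V /=.
  by apply: (can_inj (rename_can (g := inl) _)) => -[|[]].
pose g (v : option V + 'I_n) : V + 'I_n.+1 :=
  match v with
  | inl (Some v) => inl v
  | inl None => inr ord0
  | inr k => inr (lift ord0 k)
  end.
have gK : cancel (@block_assoc n V) g.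
  by move=> [//|i] /=; case: unliftP => [k ->|->].
by move=> phi psi [/IH/(can_inj (rename_can gK))].
Qed.

(** Types of group elements use $n$ variables besides those in $M$, whereas the cardinality
    assumption counts formulas with variables in $M$. Quantifying the block is an injective
    coding. *)
Lemma embeds_formula n V : embeds (formula L ('I_n + V)) (formula L V).
Proof.
pose swap (A B : Type) (s : A + B) : B + A :=
  match s with inl x => inr x | inr x => inl x end.
exists (fun phi => Alls (rename (@swap _ _) phi)).
apply: inj_comp; first exact: Alls_inj.
by apply: (can_inj (rename_can (g := @swap _ _) _)) => -[].
Qed.

Lemma embeds_set (T U : Type) : embeds T U -> embeds (set T) (set U).
Proof.
move=> [f fI]; exists (fun A => f @` A) => A B AB.
have mem (C : set T) x : (f @` C) (f x) <-> C x.
  by split=> [[y Cy /fI <-]|Cx] //; exists x.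
by apply/seteqP; split=> x; rewrite -!mem AB.
Qed.

End Coding.

(** * The normal closure of $H$ *)

Section NormalClosure.
Context (G : groupType) (H : set G).
Local Notation N := (normal_closure H).

Lemma sub_normal_closure : H `<=` N.
Proof. by move=> h Hh K [_]; apply. Qed.

Lemma normal_closure_subgroup : is_subgroup N.
Proof.
split; first by move=> K [[[K1 _ _] _] _].
  by move=> x y Nx Ny K NK; have [[[_ KM _] _] _] := NK; apply: KM; [exact: Nx|exact: Ny].
by move=> x Nx K NK; have [[[_ _ KV] _] _] := NK; apply: KV; exact: Nx.
Qed.

Lemma normal_closure_conj g x : N x -> N (g * x * g^-1).
Proof.
move=> Nx K NK; have [[_ Kn] _] := NK.
have Kg : [set g * k * g^-1 | k in K] = K := Kn g.
by rewrite -Kg; exists x => //; exact: Nx.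
Qed.

Lemma prod_normal_closure_subgroup (Z : set G) : is_subgroup Z ->
  is_subgroup (prod_set N Z).
Proof.
move=> [Z1 ZM ZV]; have [N1 NM NV] := normal_closure_subgroup; split.
- by rewrite -[1]mulg1; exact: mem_prod_set.
- move=> _ _ [n Nn [z Zz <-]] [m Nm [w Zw <-]].
  rewrite (_ : n * z * (m * w) = (n * (z * m * z^-1)) * (z * w)).
    apply: mem_prod_set; last exact: ZM.
    by apply: NM => //; exact: normal_closure_conj.
  by rewrite !mulgA mulgVK.
- move=> _ [n Nn [z Zz <-]].
  rewrite (_ : _^-1 = (z^-1 * n^-1 * z^-1^-1) * z^-1).
    by apply: mem_prod_set; [exact: (normal_closure_conj _ (NV _ Nn))|exact: ZV].
  by rewrite invgM invgK mulgK.
Qed.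

End NormalClosure.

(** * Bounded index of the closure and the conclusion *)

Section Final.
Context (L : language) (M S : structure L) (j : M -> S) (G : definable_group S)
  (K : Type) (hS : monster_model K j).
Local Notation mdef := (@mdef L M S j G).
Local Notation closed_over := (@closed_over L M S j G).
Local Notation X := (@tp_ratio L M S j G).
Local Notation Z := (set_span X).
Local Notation closure_over := (@closure_over L M S j G).
Local Notation F := (prod_set (closure_over Z) X).

Lemma set_pow_sub_mdef (P : set G) k : closed_over P -> forall D, mdef D ->
  set_pow P k `<=` D -> exists C, [/\ mdef C, P `<=` C & set_pow C k `<=` D].
Proof.
move=> Pc; elim: k => [|k IH] D Dd PD.
  by exists setT; split=> //; exact: mdefT.
have [A [B [Ad Bd PA PB AB]]] :=
  prod_set_sub_mdef hS Pc (closed_set_pow hS (k := k) Pc) Dd PD.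
have [C [Cd PC CB]] := IH B Bd PB.
exists (A `&` C); split; first exact: mdefI.
  by move=> p Pp; split; [exact: PA|exact: PC].
apply: subset_trans AB; apply: prod_setS; first by move=> ? [].
by apply: subset_trans CB; apply: set_powS => ? [].
Qed.

(** As $X\subseteq F$, a left coset of $F$ is determined by the type over $M$ of any representative,
    and there are too few types for $K$ to embed. *)
Lemma closure_span_bounded : bounded_index K F.
Proof.
move=> /card_le_setTP[f fI fP].
have [_ /smallTP + _ _] := hS; apply.
apply: embeds_trans (embeds_set (embeds_formula L (ambient_dim G) M)).
have /choice[a aP] : forall k, exists a, left_coset F a = f k.
  by move=> k; have [a _ <-] := fP k; exists a.
exists (fun k => tp j (a k)) => k l e; apply: fI; rewrite -!aP.
have [F1 FM FV] := closure_span_subgroup G hS.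
have XF : X `<=` F.
  move=> x Xx; rewrite -[x]mul1g; apply: mem_prod_set => //.
  by apply: sub_closure_over; have [] := @tp_span_subgroup L M S j G.
have h1 : F ((a k)^-1 * a l) by apply: XF; exists (a k), (a l).
have h2 : F ((a l)^-1 * a k) by apply: XF; exists (a l), (a k).
apply/seteqP; split=> x /left_cosetE Fx; apply/left_cosetE.
  by rewrite -(mulVKg (a k) x) mulgA; exact: FM.
by rewrite -(mulVKg (a l) x) mulgA; exact: FM.
Qed.

End Final.

Theorem theorem1p2 (R : realType) (kappa : Type) (L : language)
    (M S : structure L) (j : M -> S) (G : definable_group S) (H : set G)
    (hS : monster_model kappa j)
    (hH : is_subgroup H)
    (hHdef : type_definable j H)
    (hHnorm : forall g, group_points j G g -> normalizes g H)
    (hmu : carries_invariant_probability R j (left_coset H) \/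
           carries_invariant_probability R j (right_coset H)) :
  G00 j G kappa `<=` prod_set (normal_closure H) (G000 j G kappa).
Proof.
have [H1 HM HV] := hH.
have Hc := (closed_overP j H).2 hHdef.
(* Both $aH$ and $Ha$ lie in $HaH$, so either measure yields [nu]. *)
have [nu nuP] : exists nu : set G -> R, bi_measure j H nu.
  case: hmu; apply: (bi_measure_of_cosets hS hHnorm).
  - by move=> a; exists 1; rewrite ?mulg1.
  - by move=> a _ [h Hh <-]; exists 1, h; rewrite mul1g.
  - by move=> a; exists 1; rewrite ?mul1g.
  - by move=> a _ [h Hh <-]; exists h, 1; rewrite mulg1.
pose X := @tp_ratio L M S j G; pose Z := set_span X.
pose P := hull H X.
have XP : X `<=` P by exact: sub_hull.
have Zgrp : is_subgroup Z := tp_span_subgroup j G.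
have Pc : closed_over j P by have [] := bi_closed_hull hS hH Hc (closed_tp_ratio (G := G) hS).
have PV x : P x -> P x^-1.
  move=> /hullP[h [e [k [Hh Xe Hk ->]]]]; apply/hullP.
  exists k^-1, e^-1, h^-1; rewrite !invgM mulgA; split=> //; [exact: HV| |exact: HV].
  exact: tp_ratioV.
(* $P^8$ is type-definable, so it suffices to treat a definable $D\supseteq P^8$. Compactness gives
   a definable $C\supseteq P$ with $C^8\subseteq D$; once $C$ is made symmetric, all powers of $X$
   lie in $C^8$. *)
have ZP : closure_over j Z `<=` set_pow P 8.
  move=> a Za; apply: (closed_set_pow hS Pc) => D Dd PD.
  have [C [Cd PC CD]] := set_pow_sub_mdef hS Pc Dd PD.
  pose C' := C `&` [set x | C x^-1].
  have C'd : mdef j C' by apply: mdefI => //; exact: mdef_inv.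
  have C'V x : C' x -> C' x^-1 by move=> [? ?]; split=> //=; rewrite invgK.
  have PC' : P `<=` C' by move=> x Px; split; [exact: PC|apply/PC/PV].
  have C'D : set_pow C' 8 `<=` D.
    by apply: subset_trans CD; apply: set_powS => ? [].
  apply: Za => // z [k zk]; apply: C'D.
  exact: (tp_ratio_pow_sub hS hH Hc hHnorm nuP C'd C'V PC' zk).
pose NZ := prod_set (normal_closure H) Z.
have NZgrp : is_subgroup NZ by exact: prod_normal_closure_subgroup.
have [N1 NM NV] := normal_closure_subgroup H.
have [Z1 ZM ZV] := Zgrp.
have [NZ1 NZM NZV] := NZgrp.
have XNZ : X `<=` NZ.
  by move=> x Xx; rewrite -[x]mul1g; apply: mem_prod_set => //; exact: sub_set_span.
have HNZ : H `<=` NZ.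
  by move=> h Hh; rewrite -[h]mulg1; apply: mem_prod_set => //; exact: sub_normal_closure.
have PNZ : P `<=` NZ.
  move=> _ /hullP[h [x [k [Hh Xx Hk ->]]]].
  by apply: (NZM _ _ (NZM _ _ _ _)); [exact: HNZ|exact: XNZ|exact: HNZ].
have ZG : Z `<=` G000 j G kappa.
  move=> z Zz K [[Kgrp Kinv Kb] _].
  by apply: (set_span_min Kgrp (tp_ratio_sub hS Kgrp Kinv Kb) Zz).
(* [G00] is an intersection, here specialized to the member $F$; it then remains to place $F$ inside
   $NZ$. *)
move=> g /(_ (prod_set (closure_over j Z) X)).
case.
  split=> //; split.
  - exact (closure_span_subgroup G hS).
  - by apply/closed_overP; exact (@closed_closure_span _ _ _ _ G _ hS).
  - exact (closure_span_bounded hS).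
move=> a Za [x Xx <-].
have [n Nn [z Zz <-]] : NZ (a * x).
  apply: NZM; last exact: XNZ.
  apply: (set_span_min NZgrp PNZ); exists 8; exact: ZP.
by apply: mem_prod_set => //; exact: ZG.
Qed.
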